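(* Let $f_1,\dots,f_h$ ($h\ge 2$) be simultaneously formally linearizable germs of biholomorphisms of $\mathbb{C}^n$ fixing the origin whose linear parts are simultaneously diagonalizable. If $f_1,\dots,f_h$ satisfy the simultaneous Brjuno condition, then $f_1,\dots,f_h$ are holomorphically simultaneously linearizable, i.e. there is a germ of biholomorphism $\varphi$ of $(\mathbb{C}^n,0)$ with $\varphi(0)=0$ such that $\varphi^{-1}\circ f_k\circ\varphi$ is linear for every $k=1,\dots,h$.
   Context: Simultaneously formally linearizable: there is an invertible formal power series map $\varphi$, $\varphi(0)=0$, with $\varphi^{-1}\circ f_k\circ\varphi$ linear for all $k$. If the linear parts are simultaneously diagonalizable, let $\Lambda_k=(\lambda_{k,1},\dots,\lambda_{k,n})$ be the eigenvalues of the linear part of $f_k$ listed along a common eigenbasis. For $Q\in\mathbb{N}^n$ write $|Q|=\sum q_i$, $\Lambda_k^Q=\prod_i\lambda_{k,i}^{q_i}$, and $\mathrm{Res}_j(\Lambda_k)=\{Q:|Q|\ge2,\ \Lambda_k^Q=\lambda_{k,j}\}$. Set $\varepsilon_Q=\min_{1\le j\le n}\max_{1\le k\le h}|\Lambda_k^Q-\lambda_{k,j}|$ and, for $m\ge2$, $\omega(m)=\min\{\varepsilon_Q: 2\le|Q|\le m,\ Q\notin\bigcap_{k=1}^h\bigcap_{j=1}^n\mathrm{Res}_j(\Lambda_k)\}$ (with the convention $\log(1/0)=+\infty$). The germs satisfy the simultaneous Brjuno condition if there is a strictly increasing sequence of integers $(p_\nu)_{\nu\ge0}$ with $p_0=1$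 such that $\sum_{\nu\ge0}\frac1{p_\nu}\log\frac1{\omega(p_{\nu+1})}<+\infty$. *)

(* Defs.v *)
From Stdlib Require Import Reals List Arith.
Import ListNotations.
Open Scope R_scope.

Definition cplx : Type := (R * R)%type.
Definition C0 : cplx := (0, 0).
Definition C1 : cplx := (1, 0).
Definition Cadd (z w : cplx) : cplx := (fst z + fst w, snd z + snd w).
Definition Copp (z : cplx) : cplx := (- fst z, - snd z).
Definition Csub (z w : cplx) : cplx := Cadd z (Copp w).
Definition Cmul (z w : cplx) : cplx :=
  (fst z * fst w - snd z * snd w, fst z * snd w + snd z * fst w).
Fixpoint Cpow (z : cplx) (k : nat) : cplx :=
  match k with O => C1 | S k' => Cmul z (Cpow z k') end.
Definition Cnorm (z : cplx) : R := sqrt (fst z * fst z + snd z * snd z).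
Definition Csum (l : list cplx) : cplx := fold_right Cadd C0 l.

Definition Ceq_dec (z w : cplx) : {z = w} + {z <> w}.
Proof.
  destruct z as [a b], w as [c d].
  destruct (Req_EM_T a c) as [H1|H1]; [destruct (Req_EM_T b d) as [H2|H2]|].
  - left; subst; reflexivity.
  - right; intros H; inversion H; contradiction.
  - right; intros H; inversion H; contradiction.
Defined.

(* A multi-index Q in N^n is a list of length n; |Q| = sumQ Q. *)
Definition sumQ (Q : list nat) : nat := fold_right Nat.add 0%nat Q.

Fixpoint multi_le (n d : nat) : list (list nat) :=
  match n with
  | O => [ [] ]
  | S n' => flat_map (fun i => map (cons i) (multi_le n' (d - i))) (seq 0 (S d))
  end.

Fixpoint below (Q : list nat) : list (list nat) :=
  match Q with
  | [] => [ [] ]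
  | q :: Q' => flat_map (fun i => map (cons i) (below Q')) (seq 0 (S q))
  end.

Definition subQ (Q P : list nat) : list nat := map (fun qp => (fst qp - snd qp)%nat) (combine Q P).

Definition unitv (n j : nat) : list nat :=
  map (fun i => if Nat.eqb i j then 1%nat else 0%nat) (seq 0 n).

(* A scalar formal power series: coefficient of x^Q.  Only multi-indices of
   length n are relevant. *)
Definition series := list nat -> cplx.
(* A formal map C^n -> C^n: component i (i < n) is a scalar series. *)
Definition fmap := nat -> series.

Definition sone : series := fun Q => if forallb (Nat.eqb 0) Q then C1 else C0.
Definition smul (a b : series) : series :=
  fun Q => Csum (map (fun P => Cmul (a P) (b (subQ Q P))) (below Q)).
Fixpoint spow (a : series) (k : nat) : series :=
  match k with O => sone | S k' => smul a (spow a k') end.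

Fixpoint smon (phi : fmap) (P : list nat) (i0 : nat) : series :=
  match P with
  | [] => sone
  | p :: P' => smul (spow (phi i0) p) (smon phi P' (S i0))
  end.

(* composition g o phi of formal series, for phi without constant term:
   (g o phi)_Q = sum_{|P| <= |Q|} g_P (phi^P)_Q  (finite sum) *)
Definition scomp (n : nat) (g : series) (phi : fmap) : series :=
  fun Q => Csum (map (fun P => Cmul (g P) (smon phi P 0 Q)) (multi_le n (sumQ Q))).

Definition fcomp (n : nat) (F G : fmap) : fmap := fun i => scomp n (F i) G.

Definition fid (n : nat) : fmap :=
  fun i Q => if list_eq_dec Nat.eq_dec Q (unitv n i) then C1 else C0.

Definition feq (n : nat) (F G : fmap) : Prop :=
  forall i, (i < n)%nat -> forall Q, length Q = n -> F i Q = G i Q.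

Definition fixes0 (n : nat) (F : fmap) : Prop :=
  forall i, (i < n)%nat -> F i (repeat 0%nat n) = C0.

Definition is_linear (n : nat) (F : fmap) : Prop :=
  forall i, (i < n)%nat -> forall Q, length Q = n -> sumQ Q <> 1%nat -> F i Q = C0.

Definition convergent (n : nat) (F : fmap) : Prop :=
  exists r M, 0 < r /\ forall i, (i < n)%nat -> forall Q, length Q = n ->
    Cnorm (F i Q) * r ^ (sumQ Q) <= M.

Definition finverse (n : nat) (phi psi : fmap) : Prop :=
  fixes0 n phi /\ fixes0 n psi /\
  feq n (fcomp n psi phi) (fid n) /\ feq n (fcomp n phi psi) (fid n).

Definition germ_biholo0 (n : nat) (F : fmap) : Prop :=
  convergent n F /\ exists G, convergent n G /\ finverse n F G.

Definition simul_formally_linearizable (n h : nat) (f : nat -> fmap) : Prop :=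
  exists phi psi, finverse n phi psi /\
    forall k, (k < h)%nat -> is_linear n (fcomp n psi (fcomp n (f k) phi)).

Definition simul_holo_linearizable (n h : nat) (f : nat -> fmap) : Prop :=
  exists phi psi, convergent n phi /\ convergent n psi /\ finverse n phi psi /\
    forall k, (k < h)%nat -> is_linear n (fcomp n psi (fcomp n (f k) phi)).

Definition linpart (n : nat) (F : fmap) (i j : nat) : cplx := F i (unitv n j).

Definition matmul (n : nat) (A B : nat -> nat -> cplx) (i j : nat) : cplx :=
  Csum (map (fun l => Cmul (A i l) (B l j)) (seq 0 n)).

Definition idmx (i j : nat) : cplx := if Nat.eqb i j then C1 else C0.

Definition mxeq (n : nat) (A B : nat -> nat -> cplx) : Prop :=
  forall i j, (i < n)%nat -> (j < n)%nat -> A i j = B i j.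

Definition common_eigenbasis (n h : nat) (f : nat -> fmap)
    (P : nat -> nat -> cplx) (lam : nat -> nat -> cplx) : Prop :=
  (exists Pinv, mxeq n (matmul n P Pinv) idmx /\ mxeq n (matmul n Pinv P) idmx) /\
  forall k, (k < h)%nat ->
    mxeq n (matmul n (linpart n (f k)) P) (fun i j => Cmul (P i j) (lam k j)).

Fixpoint Cmon (lamk : nat -> cplx) (Q : list nat) (i0 : nat) : cplx :=
  match Q with
  | [] => C1
  | q :: Q' => Cmul (Cpow (lamk i0) q) (Cmon lamk Q' (S i0))
  end.

Definition maxl (l : list R) : R :=
  match l with [] => 0 | x :: l' => fold_right Rmax x l' end.
Definition minl (l : list R) : R :=
  match l with [] => 0 | x :: l' => fold_right Rmin x l' end.

Definition epsQ (n h : nat) (lam : nat -> nat -> cplx) (Q : list nat) : R :=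
  minl (map (fun j =>
    maxl (map (fun k => Cnorm (Csub (Cmon (lam k) Q 0) (lam k j))) (seq 0 h)))
    (seq 0 n)).

(* Q in the intersection over k and j of Res_j(Lambda_k) (given |Q| >= 2) *)
Definition totally_resonant (n h : nat) (lam : nat -> nat -> cplx) (Q : list nat) : bool :=
  forallb (fun k => forallb (fun j =>
     if Ceq_dec (Cmon (lam k) Q 0) (lam k j) then true else false) (seq 0 n)) (seq 0 h).

Definition omega_cands (n h : nat) (lam : nat -> nat -> cplx) (m : nat) : list (list nat) :=
  filter (fun Q => andb (Nat.leb 2 (sumQ Q)) (negb (totally_resonant n h lam Q)))
         (multi_le n m).

Definition omega (n h : nat) (lam : nat -> nat -> cplx) (m : nat) : option R :=
  match map (epsQ n h lam) (omega_cands n h lam m) with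
  | [] => None
  | x :: l => Some (fold_right Rmin x l)
  end.

(* log(1/omega(m)); only used when omega(m) <> Some 0 (the case
   log(1/0) = +oo is excluded separately); empty minimum contributes 0 *)
Definition brjuno_term (n h : nat) (lam : nat -> nat -> cplx) (m : nat) : R :=
  match omega n h lam m with
  | None => 0
  | Some w => ln (/ w)
  end.

Definition Rsum_upto (N : nat) (u : nat -> R) : R :=
  fold_right Rplus 0 (map u (seq 0 N)).

Definition simul_brjuno (n h : nat) (lam : nat -> nat -> cplx) : Prop :=
  exists p : nat -> nat,
    p 0%nat = 1%nat /\ (forall nu, (p nu < p (S nu))%nat) /\
    (forall nu, omega n h lam (p (S nu)) <> Some 0) /\
    exists M, forall N,
      Rsum_upto N (fun nu => / INR (p nu) * brjuno_term n h lam (p (S nu))) <= M.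

(* Main.v *)
(** A resonance that is not total makes [omega] vanish, so the Brjuno condition leaves two cases.

    If some multi-index is totally resonant, then all linear parts are scalar and their eigenvalues are
    roots of unity; a formal linearization shows that the [f_k] generate a finite abelian group, and
    averaging the identity over this group gives a convergent linearization.

    Otherwise the formal linearization tangent to the identity is unique, and its coefficients satisfy
    [eps_Q |phi_Q| <= sum_k |(G_k o phi)_Q|], where [G_k] is the nonlinear part of [f_k] in
    coordinates diagonalizing the linear parts.  Siegel's majorant method is run in the norm with weights [t^|Q| exp (- K Q)], where [K Q <= c |Q|] and
    [K (P + R) >= K P + K R + log (1 / eps_(P + R))] for nonzero [P] and [R]: the small divisors disappear
    from the estimate.  Such a [K] is built from the Brjuno series and the fact that if [Q] and [Q + R] both
    have divisors much smaller than [omega m], then [|R| >= m]. *)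

From Stdlib Require Import Reals List Arith Lia Lra Permutation Setoid Morphisms.
From Stdlib Require Import Classical ClassicalEpsilon.
Require Import Defs.
Import ListNotations.

(** The cases differ in whether the given formal linearization can be trusted to converge. Without
    total resonances each coefficient of degree at least 2 is determined by those of lower degree,
    and the formal map, once normalized, is itself shown to converge. With a total resonance it can
    be composed with any formal map commuting with the scalar linear parts, so it may diverge; it
    then serves only to verify identities between convergent maps.

    The classical argument expands each coefficient over trees and counts the small divisors in each
    tree. Superadditivity of [K] replaces this count: the divisor met when P and R are joined is
    paid by the increase of [K], so a single product inequality for the weighted norm treats all
    trees at once, and the linear bound on [K] makes the total cost a mere change of radius. Degrees
    are treated up to a bound [B], with a constant independent of [B]; hence all sums are finite and
    no series is ever summed. *)

Lemma cplx_eq (z w : cplx) : fst z = fst w -> snd z = snd w -> z = w.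
Proof. destruct z, w; simpl; congruence. Qed.

Lemma cplx_ring : ring_theory C0 C1 Cadd Cmul Csub Copp eq.
Proof. constructor; intros; try reflexivity; apply cplx_eq; simpl; ring. Qed.

Add Ring cplx_ring : cplx_ring.

(** * Finite sums over lists in a commutative monoid, used for both complex and real sums *)

Class CMonoid {A : Type} (zero : A) (add : A -> A -> A) : Prop := {
  cm_comm : forall x y, add x y = add y x;
  cm_assoc : forall x y z, add x (add y z) = add (add x y) z;
  cm_zero : forall x, add zero x = x }.

#[global] Instance cplx_cmonoid : CMonoid C0 Cadd.
Proof. constructor; intros; ring. Qed.

#[global] Instance R_cmonoid : CMonoid 0 Rplus.
Proof. constructor; intros; ring. Qed.

Section Sums.
Context {A : Type} {zero : A} {add : A -> A -> A} {cm : CMonoid zero add}.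

Definition lsum {I : Type} (l : list I) (F : I -> A) : A := fold_right add zero (map F l).

Lemma cm_zero_r x : add x zero = x.
Proof. rewrite cm_comm; apply cm_zero. Qed.

Lemma cm_swap x y z : add x (add y z) = add y (add x z).
Proof. now rewrite (cm_assoc x), (cm_comm x y), <- cm_assoc. Qed.

Lemma lsum_ext {I} (l : list I) F G :
  (forall x, In x l -> F x = G x) -> lsum l F = lsum l G.
Proof. intros H; unfold lsum; now rewrite (map_ext_in _ _ _ H). Qed.

Lemma lsum_zero {I} (l : list I) F : (forall x, In x l -> F x = zero) -> lsum l F = zero.
Proof.
  induction l as [|x l IH]; intros H; [reflexivity|].
  unfold lsum in *; simpl; rewrite IH by (intros; apply H; simpl; auto).
  rewrite H by (simpl; auto); apply cm_zero.
Qed.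

Lemma lsum_add {I} (l : list I) F G :
  lsum l (fun x => add (F x) (G x)) = add (lsum l F) (lsum l G).
Proof.
  induction l as [|x l IH]; unfold lsum in *; simpl.
  - now rewrite cm_zero.
  - rewrite IH, <- !cm_assoc; f_equal; apply cm_swap.
Qed.

Lemma lsum_exchange {I J} (l : list I) (l' : list J) F :
  lsum l (fun x => lsum l' (F x)) = lsum l' (fun y => lsum l (fun x => F x y)).
Proof.
  induction l as [|x l IH].
  - symmetry; apply lsum_zero; reflexivity.
  - change (add (lsum l' (F x)) (lsum l (fun x => lsum l' (F x))) =
            lsum l' (fun y => add (F x y) (lsum l (fun x => F x y)))).
    rewrite lsum_add, IH; reflexivity.
Qed.

Lemma lsum_perm {I} (l l' : list I) F : Permutation l l' -> lsum l F = lsum l' F.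
Proof.
  induction 1; unfold lsum in *; simpl; try congruence. apply cm_swap.
Qed.

(** Sums over index sets that depend on Q, such as [below Q], are extended by zero terms to one
    common set, where the order of summation can be exchanged. *)
Lemma lsum_incl {I} (l' l : list I) F :
  NoDup l' -> incl l' l -> NoDup l -> (forall x, In x l -> ~ In x l' -> F x = zero) ->
  lsum l F = lsum l' F.
Proof.
  intros H'; revert l; induction H' as [|x l' Hx _ IH]; intros l Hi Hl Hz.
  - apply lsum_zero; intros; apply Hz; auto.
  - destruct (in_split x l) as (l1 & l2 & ->); [apply Hi; simpl; auto|].
    rewrite (lsum_perm _ (x :: l1 ++ l2)) by (symmetry; apply Permutation_middle).
    unfold lsum at 1 2; simpl; f_equal; apply (IH (l1 ++ l2)).
    + intros y Hy; assert (In y (l1 ++ x :: l2)) as H1 by (apply Hi; simpl; auto).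
      apply in_app_iff in H1; simpl in H1; apply in_app_iff; intuition; subst; tauto.
    + eapply NoDup_remove_1; eauto.
    + intros y Hy Hn; apply Hz.
      * apply in_app_iff in Hy; apply in_app_iff; simpl; tauto.
      * simpl; intros [->|Hy']; [|tauto].
        apply NoDup_remove_2 in Hl; tauto.
Qed.

Lemma lsum_delta {I} (l : list I) y F :
  NoDup l -> In y l -> (forall x, In x l -> x <> y -> F x = zero) -> lsum l F = F y.
Proof.
  intros Hl Hy Hz; rewrite (lsum_incl [y] l).
  - unfold lsum; simpl; apply cm_zero_r.
  - repeat constructor; auto.
  - intros x [->|[]]; auto.
  - auto.
  - intros x Hx Hn; apply Hz; simpl in Hn; intuition.
Qed.

Lemma lsum_app {I} (l l' : list I) F : lsum (l ++ l') F = add (lsum l F) (lsum l' F).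
Proof.
  induction l; unfold lsum in *; simpl.
  - now rewrite cm_zero.
  - rewrite IHl; apply cm_assoc.
Qed.

Lemma lsum_hom {I} (phi : A -> A) (l : list I) F :
  phi zero = zero -> (forall x y, phi (add x y) = add (phi x) (phi y)) ->
  phi (lsum l F) = lsum l (fun x => phi (F x)).
Proof.
  intros H0 Ha; induction l; unfold lsum in *; simpl; [auto|]. now rewrite Ha, IHl.
Qed.

End Sums.

Arguments lsum {A} zero add {I} l F.
Notation csum := (lsum C0 Cadd).
Notation rsum := (lsum 0 Rplus).

Lemma CsumE {I} (l : list I) F : Csum (map F l) = csum l F.
Proof. reflexivity. Qed.

Lemma csum_scal {I} (l : list I) c F : Cmul c (csum l F) = csum l (fun x => Cmul c (F x)).
Proof. apply (lsum_hom (Cmul c)); intros; ring. Qed.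

Lemma csum_scal_r {I} (l : list I) c F : Cmul (csum l F) c = csum l (fun x => Cmul (F x) c).
Proof. apply (lsum_hom (fun z => Cmul z c)); intros; ring. Qed.

(** * Multi-indices *)

Definition Qdec := list_eq_dec Nat.eq_dec.

Fixpoint addQ (P R : list nat) : list nat :=
  match P, R with p :: P, r :: R => (p + r)%nat :: addQ P R | _, _ => [] end.

Notation zeroQ n := (repeat 0%nat n).

Lemma addQ_length P R n : length P = n -> length R = n -> length (addQ P R) = n.
Proof.
  revert R n; induction P; intros [|r R] [|n]; simpl; intros; try lia. f_equal; apply IHP; lia.
Qed.

Lemma addQ_sum P R : length P = length R -> sumQ (addQ P R) = (sumQ P + sumQ R)%nat.
Proof. revert R; induction P; intros [|r R]; simpl; intros; try lia. rewrite IHP; lia. Qed.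

Lemma addQ_comm P R : addQ P R = addQ R P.
Proof. revert R; induction P; intros [|r R]; simpl; auto. rewrite IHP; f_equal; lia. Qed.

Lemma addQ_assoc P R S : addQ (addQ P R) S = addQ P (addQ R S).
Proof.
  revert R S; induction P; intros [|r R] [|t S]; simpl; auto. rewrite IHP; f_equal; lia.
Qed.

Lemma addQ_0 P : addQ P (zeroQ (length P)) = P.
Proof. induction P; simpl; auto. f_equal; auto. Qed.

Lemma zeroQ_sum n : sumQ (zeroQ n) = 0%nat.
Proof. induction n; auto. Qed.

Lemma sumQ_0 Q : sumQ Q = 0%nat -> Q = zeroQ (length Q).
Proof. induction Q; simpl; intros; auto. f_equal; [lia|apply IHQ; lia]. Qed.

Lemma sumQ_pos n Q : length Q = n -> Q <> zeroQ n -> (1 <= sumQ Q)%nat.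
Proof. intros HQ H; destruct (sumQ Q) eqn:E; [|lia]. apply sumQ_0 in E; congruence. Qed.

Lemma unitv_O n : unitv (S n) 0 = 1%nat :: zeroQ n.
Proof.
  unfold unitv; simpl; f_equal. rewrite <- seq_shift, map_map; simpl.
  assert (forall k, map (fun _ : nat => 0%nat) (seq k n) = zeroQ n) as H; [|apply H].
  induction n; simpl; intros; f_equal; auto.
Qed.

Lemma unitv_S n j : unitv (S n) (S j) = 0%nat :: unitv n j.
Proof. unfold unitv; simpl; f_equal. rewrite <- seq_shift, map_map; reflexivity. Qed.

Lemma unitv_length n j : length (unitv n j) = n.
Proof. unfold unitv; rewrite length_map, length_seq; reflexivity. Qed.

Lemma unitv_sum n j : (j < n)%nat -> sumQ (unitv n j) = 1%nat.
Proof.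
  revert j; induction n; intros j H; [lia|]; destruct j.
  - rewrite unitv_O; simpl; now rewrite zeroQ_sum.
  - rewrite unitv_S; simpl; apply IHn; lia.
Qed.

Lemma unitv_inj n i j : (i < n)%nat -> unitv n i = unitv n j -> i = j.
Proof.
  revert i j; induction n; intros i j H E; [lia|].
  destruct i, j; rewrite ?unitv_O, ?unitv_S in E; try discriminate; auto.
  f_equal; apply IHn; [lia|congruence].
Qed.

Lemma midx_cases n P : length P = n ->
  P = zeroQ n \/ exists i P', (i < n)%nat /\ length P' = n /\ P = addQ (unitv n i) P'.
Proof.
  revert n; induction P as [|p P IH]; intros n H; simpl in H; subst n; [left; auto|].
  destruct p.
  - destruct (IH _ eq_refl) as [E|(i & P' & Hi & HP & E)].
    + left; simpl; congruence.
    + right; exists (S i), (0%nat :: P'); rewrite unitv_S; simpl; repeat split; try lia; congruence.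
  - right; exists 0%nat, (p :: P); rewrite unitv_O; simpl; repeat split; try lia.
    rewrite addQ_comm, addQ_0; reflexivity.
Qed.

(** Structural induction on the list would change the number of variables and the start index of
    [smon]. Adding unit vectors keeps the length n and corresponds to multiplying a monomial by one
    factor ([smon_step]). *)
Lemma midx_ind n (X : list nat -> Prop) :
  X (zeroQ n) ->
  (forall i P, (i < n)%nat -> length P = n -> X P -> X (addQ (unitv n i) P)) ->
  forall P, length P = n -> X P.
Proof.
  intros H0 HS P; remember (sumQ P) as s eqn:E; revert P E.
  induction s as [s IH] using lt_wf_ind; intros P E HP.
  destruct (midx_cases n P HP) as [->|(i & P' & Hi & HP' & ->)]; auto.
  apply HS; auto. apply (IH (sumQ P')); auto.
  rewrite addQ_sum, unitv_sum in E by (rewrite ?unitv_length; auto). lia.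
Qed.

Lemma sumQ_1 n P : length P = n -> sumQ P = 1%nat -> exists i, (i < n)%nat /\ P = unitv n i.
Proof.
  intros HP E; destruct (midx_cases n P HP) as [->|(i & P' & Hi & HP' & ->)].
  - rewrite zeroQ_sum in E; lia.
  - rewrite addQ_sum, unitv_sum in E by (rewrite ?unitv_length; auto).
    exists i; split; auto. replace P' with (zeroQ n).
    + rewrite <- (unitv_length n i) at 2. apply addQ_0.
    + rewrite <- HP'; symmetry; apply sumQ_0; lia.
Qed.

Lemma in_cons_flat_map {l : list nat} {f : nat -> list (list nat)} {q Q} :
  In (q :: Q) (flat_map (fun i => map (cons i) (f i)) l) <-> In q l /\ In Q (f q).
Proof.
  rewrite in_flat_map; split.
  - intros (x & Hx & H). apply in_map_iff in H; destruct H as (y & E & Hy); injection E; intros; subst; auto.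
  - intros [H1 H2]; exists q; split; auto. apply in_map; auto.
Qed.

Lemma nil_flat_map {l : list nat} {f : nat -> list (list nat)} :
  ~ In [] (flat_map (fun i => map (cons i) (f i)) l).
Proof.
  rewrite in_flat_map; intros (x & Hx & H). apply in_map_iff in H; destruct H as (y & E & Hy); discriminate.
Qed.

Lemma NoDup_cons_flat_map (l : list nat) (f : nat -> list (list nat)) :
  NoDup l -> (forall i, NoDup (f i)) -> NoDup (flat_map (fun i => map (cons i) (f i)) l).
Proof.
  intros Hl Hf; induction Hl as [|x l Hx Hl IH]; simpl; [constructor|].
  apply NoDup_app; auto.
  - apply FinFun.Injective_map_NoDup; auto. intros a b E; congruence.
  - intros Q HQ H. apply in_map_iff in HQ; destruct HQ as (y & <- & Hy).
    apply in_cons_flat_map in H; tauto.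
Qed.

Lemma in_multi_le n d Q : In Q (multi_le n d) <-> length Q = n /\ (sumQ Q <= d)%nat.
Proof.
  revert d Q; induction n; intros d Q.
  - simpl; split; [intros [<-|[]]; simpl; split; lia|].
    intros [H _]; destruct Q; simpl in H; [auto|lia].
  - change (multi_le (S n) d) with
      (flat_map (fun i => map (cons i) (multi_le n (d - i))) (seq 0 (S d))).
    destruct Q as [|q Q].
    + split; [intros H; now apply nil_flat_map in H|simpl; intros []; lia].
    + rewrite in_cons_flat_map, IHn, in_seq; simpl; lia.
Qed.

Lemma NoDup_multi_le n d : NoDup (multi_le n d).
Proof.
  revert d; induction n; intros d; simpl multi_le.
  - repeat constructor; auto.
  - apply (NoDup_cons_flat_map (seq 0 (S d)) (fun i => multi_le n (d - i))); auto using seq_NoDup.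
Qed.

Lemma in_below Q P : In P (below Q) <-> length P = length Q /\ Q = addQ P (subQ Q P).
Proof.
  revert P; induction Q as [|q Q IH]; intros P.
  - simpl; destruct P; simpl; intuition (auto; discriminate).
  - change (below (q :: Q)) with (flat_map (fun i => map (cons i) (below Q)) (seq 0 (S q))).
    destruct P as [|p P].
    + split; [intros H; now apply nil_flat_map in H|simpl; intros []; lia].
    + rewrite in_cons_flat_map, IH, in_seq; unfold subQ; simpl.
      change (map (fun qp => (fst qp - snd qp)%nat) (combine Q P)) with (subQ Q P).
      split; [intros (?&?&?)|intros (?&E); injection E; intros]; repeat split; try lia; auto.
      f_equal; [lia|auto].
Qed.

Lemma NoDup_below Q : NoDup (below Q).
Proof.
  induction Q; simpl below; [repeat constructor; auto|].
  apply (NoDup_cons_flat_map (seq 0 (S a)) (fun _ => below Q)); auto using seq_NoDup.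
Qed.

Lemma subQ_addQ P R : length P = length R -> subQ (addQ P R) P = R.
Proof.
  revert R; induction P; intros [|r R]; unfold subQ; simpl; intros; try lia; auto.
  f_equal; [lia|]. apply IHP; lia.
Qed.

Lemma subQ_length Q P : length P = length Q -> length (subQ Q P) = length Q.
Proof. intros; unfold subQ; rewrite length_map, length_combine; lia. Qed.

(** * The ring of formal series *)

(** The convolution becomes a sum over all pairs with the indicator of P + R = Q. The index set no
    longer depends on Q, so the ring laws and the norm inequalities reduce to exchanging sums. *)
Lemma smulE n N a b Q : length Q = n -> (sumQ Q <= N)%nat ->
  smul a b Q = csum (multi_le n N) (fun P => csum (multi_le n N) (fun R =>
    if Qdec (addQ P R) Q then Cmul (a P) (b R) else C0)).
Proof.
  intros HQ HN; unfold smul.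
  change (csum (below Q) (fun P => Cmul (a P) (b (subQ Q P))) = 
   csum (multi_le n N) (fun P => csum (multi_le n N) (fun R =>
    if Qdec (addQ P R) Q then Cmul (a P) (b R) else C0))).
  rewrite (lsum_incl (below Q) (multi_le n N)); auto using NoDup_below, NoDup_multi_le.
  - apply lsum_ext; intros P HP; apply in_below in HP; destruct HP as [HP E].
    assert (sumQ Q = sumQ P + sumQ (subQ Q P))%nat as Es.
    { rewrite E at 1; apply addQ_sum; rewrite subQ_length; auto. }
    rewrite (lsum_delta _ (subQ Q P)).
    + rewrite <- E; destruct (Qdec Q Q); congruence.
    + apply NoDup_multi_le.
    + apply in_multi_le; rewrite subQ_length by auto; split; lia.
    + intros R HR Hn; apply in_multi_le in HR; destruct (Qdec (addQ P R) Q) as [E'|]; auto.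
      destruct Hn; rewrite <- E', subQ_addQ; auto; lia.
  - intros P HP; apply in_below in HP; destruct HP as [HP E]; apply in_multi_le; split; [lia|].
    assert (sumQ Q = sumQ P + sumQ (subQ Q P))%nat; [|lia].
    rewrite E at 1; apply addQ_sum; rewrite subQ_length; auto.
  - intros P HP Hn; apply in_multi_le in HP; apply lsum_zero; intros R HR; apply in_multi_le in HR.
    destruct (Qdec (addQ P R) Q) as [E|]; auto. destruct Hn; apply in_below; split; [lia|].
    rewrite <- E at 1; f_equal; rewrite <- E, subQ_addQ; auto; lia.
Qed.

(** A series is a function on lists of every length, but only its values at length n have a meaning;
    hence a setoid equality instead of [eq]. *)
Definition sereq (n : nat) (a b : series) : Prop := forall Q, length Q = n -> a Q = b Q.

#[global] Instance sereq_equiv n : Equivalence (sereq n).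
Proof.
  split; red; unfold sereq; auto.
  - intros a b H Q HQ; symmetry; auto.
  - intros a b c H H' Q HQ; rewrite H; auto.
Qed.

#[global] Instance smul_proper n : Proper (sereq n ==> sereq n ==> sereq n) smul.
Proof.
  intros a a' Ha b b' Hb Q HQ; rewrite !(smulE n (sumQ Q)) by auto.
  apply lsum_ext; intros P HP; apply lsum_ext; intros R HR.
  apply in_multi_le in HP, HR; rewrite Ha, Hb by tauto; reflexivity.
Qed.

Lemma smul_comm n a b : sereq n (smul a b) (smul b a).
Proof.
  intros Q HQ; rewrite !(smulE n (sumQ Q)) by auto; rewrite lsum_exchange.
  apply lsum_ext; intros P HP; apply lsum_ext; intros R HR; rewrite addQ_comm.
  destruct Qdec; auto; ring.
Qed.

(** A form symmetric in the three factors, so that associativity becomes a permutation of three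
    summations. *)
Lemma smul3E n N a b c Q : length Q = n -> (sumQ Q <= N)%nat ->
  smul (smul a b) c Q = csum (multi_le n N) (fun P => csum (multi_le n N) (fun R =>
    csum (multi_le n N) (fun T => 
    if Qdec (addQ (addQ P R) T) Q then Cmul (Cmul (a P) (b R)) (c T) else C0))).
Proof.
  intros HQ HN; rewrite (smulE n N) by auto.
  set (I := multi_le n N).
  transitivity (csum I (fun T => csum I (fun P => csum I (fun R => csum I (fun U =>
    if Qdec (addQ P R) U then if Qdec (addQ U T) Q then Cmul (Cmul (a P) (b R)) (c T) else C0 else C0))))).
  - rewrite lsum_exchange; apply lsum_ext; intros T HT.
    transitivity (csum I (fun U => csum I (fun P => csum I (fun R =>
      if Qdec (addQ P R) U then if Qdec (addQ U T) Q then Cmul (Cmul (a P) (b R)) (c T) else C0 else C0)))).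
    + apply lsum_ext; intros U HU. apply in_multi_le in HU.
      destruct (Qdec (addQ U T) Q).
      * rewrite (smulE n N) by tauto. fold I. rewrite csum_scal_r; apply lsum_ext; intros P HP.
        rewrite csum_scal_r; apply lsum_ext; intros R HR. destruct Qdec; auto; ring.
      * symmetry; apply lsum_zero; intros; apply lsum_zero; intros; destruct Qdec; auto.
    + rewrite lsum_exchange; apply lsum_ext; intros P HP; apply lsum_exchange.
  - rewrite lsum_exchange; apply lsum_ext; intros P HP.
    rewrite lsum_exchange; apply lsum_ext; intros R HR.
    apply lsum_ext; intros T HT. apply in_multi_le in HP, HR, HT.
    destruct (Qdec (addQ (addQ P R) T) Q) as [E|E].
    + rewrite (lsum_delta _ (addQ P R)).
      * destruct Qdec; [|congruence]. destruct Qdec; congruence.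
      * apply NoDup_multi_le.
      * apply in_multi_le; split; [apply addQ_length; tauto|].
        rewrite <- E, addQ_sum in HN; [lia|]. rewrite (addQ_length _ _ n); lia.
      * intros; destruct Qdec; congruence.
    + apply lsum_zero; intros U HU. destruct Qdec; auto. subst; destruct Qdec; congruence.
Qed.

Lemma smul_assoc n a b c : sereq n (smul (smul a b) c) (smul a (smul b c)).
Proof.
  (* Commutativity turns the right side into (bc)a, to which the same triple sum formula applies. *)
  intros Q HQ; rewrite (smul_comm n a _ Q HQ), !(smul3E n (sumQ Q)) by auto.
  rewrite lsum_exchange. apply lsum_ext; intros R HR.
  rewrite lsum_exchange. apply lsum_ext; intros T HT.
  apply lsum_ext; intros P HP.
  replace (addQ (addQ R T) P) with (addQ (addQ P R) T)
    by (rewrite (addQ_comm _ P), addQ_assoc; reflexivity).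
  destruct Qdec; auto; ring.
Qed.

Lemma soneE n Q : length Q = n -> sone Q = if Qdec Q (zeroQ n) then C1 else C0.
Proof.
  intros HQ; unfold sone.
  destruct (forallb (Nat.eqb 0) Q) eqn:E; destruct Qdec as [E'|E']; auto.
  - destruct E'; rewrite <- HQ; clear -E; induction Q; simpl in *; auto.
    apply andb_prop in E; destruct E as [H1 H2]; destruct a; [|discriminate]; rewrite <- IHQ; auto.
  - rewrite E' in E; clear -E; induction n; simpl in *; [discriminate|auto].
Qed.

Lemma smul_1_l n a : sereq n (smul sone a) a.
Proof.
  intros Q HQ; rewrite (smulE n (sumQ Q)) by auto.
  rewrite (lsum_delta _ (zeroQ n)).
  - rewrite (lsum_delta _ Q).
    + rewrite addQ_comm, <- HQ, addQ_0, (soneE n), HQ by (rewrite repeat_length; auto).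
      destruct Qdec; [|congruence]. destruct Qdec; [ring|congruence].
    + apply NoDup_multi_le.
    + apply in_multi_le; auto.
    + intros R HR Hn; apply in_multi_le in HR; destruct Qdec as [E|]; auto.
      rewrite addQ_comm, <- (proj1 HR), addQ_0 in E; congruence.
  - apply NoDup_multi_le.
  - apply in_multi_le; rewrite repeat_length, zeroQ_sum; split; auto; lia.
  - intros P HP Hn; apply in_multi_le in HP; apply lsum_zero; intros; rewrite (soneE n) by tauto.
    destruct (Qdec P _); [congruence|]. destruct Qdec; auto; ring.
Qed.

Lemma smul_1_r n a : sereq n (smul a sone) a.
Proof. rewrite smul_comm; apply smul_1_l. Qed.

Lemma smul_swap4 n a b c d :
  sereq n (smul (smul a b) (smul c d)) (smul (smul a c) (smul b d)).
Proof.
  rewrite !smul_assoc, <- (smul_assoc n b c d), (smul_comm n b c), (smul_assoc n c b d).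
  reflexivity.
Qed.

Lemma spow_add n a p q : sereq n (spow a (p + q)) (smul (spow a p) (spow a q)).
Proof.
  induction p; simpl.
  - now rewrite smul_1_l.
  - now rewrite IHp, smul_assoc.
Qed.

Lemma smon_add n phi P R i : length P = length R ->
  sereq n (smon phi (addQ P R) i) (smul (smon phi P i) (smon phi R i)).
Proof.
  revert R i; induction P; intros [|r R]; simpl; intros i H; try lia.
  - now rewrite smul_1_l.
  - now rewrite IHP, spow_add, smul_swap4 by lia.
Qed.

Lemma smon_0 n phi k i : sereq n (smon phi (zeroQ k) i) sone.
Proof. revert i; induction k; simpl; intros; [reflexivity|]. now rewrite IHk, smul_1_l. Qed.

Lemma smon_unitv n phi k j i : (j < k)%nat -> sereq n (smon phi (unitv k j) i) (phi (j + i)%nat).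
Proof.
  revert j i; induction k; intros j i H; [lia|]; destruct j.
  - rewrite unitv_O; simpl. now rewrite smon_0, !smul_1_r.
  - rewrite unitv_S; simpl. rewrite smul_1_l, IHk by lia. now replace (S (j + i)) with (j + S i)%nat by lia.
Qed.

Lemma smon_step n phi i P : (i < n)%nat -> length P = n ->
  sereq n (smon phi (addQ (unitv n i) P) 0) (smul (phi i) (smon phi P 0)).
Proof.
  intros; rewrite smon_add, smon_unitv by (auto; now rewrite unitv_length).
  now rewrite Nat.add_0_r.
Qed.

#[global] Instance feq_equiv n : Equivalence (feq n).
Proof.
  split; red; unfold feq; auto.
  - intros a b H i Hi Q HQ; symmetry; auto.
  - intros a b c H H' i Hi Q HQ; rewrite H; auto.
Qed.

Lemma feq_sereq n F G i : feq n F G -> (i < n)%nat -> sereq n (F i) (G i).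
Proof. intros H Hi Q HQ; auto. Qed.

Lemma smon_ext n phi phi' P : feq n phi phi' -> length P = n ->
  sereq n (smon phi P 0) (smon phi' P 0).
Proof.
  intros H; revert P; apply midx_ind.
  - now rewrite !smon_0.
  - intros i P Hi HP IH. now rewrite !smon_step, IH, (feq_sereq n _ _ i H) by auto.
Qed.

(** Every factor starts in degree 1, so phi^P starts in degree |P|. This is what makes composition a
    finite sum in each degree. *)
Lemma smon_order n phi P Q : fixes0 n phi -> length P = n -> length Q = n ->
  (sumQ Q < sumQ P)%nat -> smon phi P 0 Q = C0.
Proof.
  intros H0 HP; revert Q; pattern P; revert P HP; apply midx_ind.
  - rewrite zeroQ_sum; lia.
  - intros i P Hi HP IH Q HQ Hl.
    rewrite (smon_step n) by auto. rewrite (smulE n (sumQ Q)) by auto.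
    apply lsum_zero; intros U HU; apply lsum_zero; intros V HV; apply in_multi_le in HU, HV.
    destruct (Qdec _ Q) as [E|]; auto.
    destruct (Qdec U (zeroQ n)) as [->|Hn]; [rewrite H0 by auto; ring|].
    rewrite IH; [ring|tauto|]. apply (sumQ_pos n) in Hn; [|tauto].
    rewrite <- E, !addQ_sum, unitv_sum in Hl by (rewrite ?unitv_length; lia). lia.
Qed.

(** * Composition *)

(** The cutoff is freed from Q, so that several compositions can share one index set. *)
Lemma scompE n N g phi Q : fixes0 n phi -> length Q = n -> (sumQ Q <= N)%nat ->
  scomp n g phi Q = csum (multi_le n N) (fun P => Cmul (g P) (smon phi P 0 Q)).
Proof.
  intros H0 HQ HN; symmetry; apply lsum_incl; auto using NoDup_multi_le.
  - intros P HP; apply in_multi_le in HP; apply in_multi_le; lia.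
  - intros P HP Hn; rewrite in_multi_le in HP, Hn; rewrite (smon_order n); try tauto; [ring|lia].
Qed.

#[global] Instance scomp_proper n : Proper (sereq n ==> feq n ==> sereq n) (scomp n).
Proof.
  intros g g' Hg phi phi' Hp Q HQ; apply lsum_ext; intros P HP; apply in_multi_le in HP.
  rewrite Hg, (smon_ext n phi phi') by tauto; reflexivity.
Qed.

#[global] Instance fcomp_proper n : Proper (feq n ==> feq n ==> feq n) (fcomp n).
Proof. intros F F' HF G G' HG i Hi; apply scomp_proper; auto. intros Q; apply HF; auto. Qed.

(** Both sides equal the sum over P and R of a_P b_R (phi^(P+R))_Q: on the left after summing out T
    = P + R, on the right after splitting phi^(P+R) by [smon_add]. *)
Lemma scomp_smul n a b phi : fixes0 n phi ->
  sereq n (scomp n (smul a b) phi) (smul (scomp n a phi) (scomp n b phi)).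
Proof.
  intros H0 Q HQ; set (N := sumQ Q); set (I := multi_le n N).
  rewrite (scompE n N), (smulE n N) by (auto; unfold N; lia); fold I.
  transitivity (csum I (fun P => csum I (fun R => Cmul (Cmul (a P) (b R)) (smon phi (addQ P R) 0 Q)))).
  - transitivity (csum I (fun T => csum I (fun P => csum I (fun R =>
      if Qdec (addQ P R) T then Cmul (Cmul (a P) (b R)) (smon phi T 0 Q) else C0)))).
    + apply lsum_ext; intros T HT; apply in_multi_le in HT; rewrite (smulE n N) by tauto; fold I.
      rewrite csum_scal_r; apply lsum_ext; intros; rewrite csum_scal_r; apply lsum_ext; intros.
      destruct Qdec; auto; ring.
    + rewrite lsum_exchange; apply lsum_ext; intros P HP.
      rewrite lsum_exchange; apply lsum_ext; intros R HR.
      apply in_multi_le in HP, HR.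
      assert (length (addQ P R) = n) as HPR by (apply addQ_length; tauto).
      destruct (le_lt_dec (sumQ (addQ P R)) N) as [Hs|Hs].
      * rewrite (lsum_delta _ (addQ P R)); [destruct Qdec; congruence|apply NoDup_multi_le|
          now apply in_multi_le|intros; destruct Qdec; congruence].
      (* Here P + R lies beyond the cutoff and no T matches it, but phi^(P+R) has no term in degree
         |Q| either. *)
      * rewrite (smon_order n) by auto. rewrite lsum_zero; [ring|].
        intros T HT; apply in_multi_le in HT; destruct Qdec; auto; subst; lia.
  - transitivity (csum I (fun P => csum I (fun R => csum I (fun U => csum I (fun V =>
      if Qdec (addQ U V) Q then Cmul (Cmul (a P) (smon phi P 0 U)) (Cmul (b R) (smon phi R 0 V)) else C0))))).
    + apply lsum_ext; intros P HP; apply lsum_ext; intros R HR; apply in_multi_le in HP, HR.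
      rewrite (smon_add n) by (auto; lia). rewrite (smulE n N) by (auto; unfold N; lia); fold I.
      rewrite csum_scal; apply lsum_ext; intros; rewrite csum_scal; apply lsum_ext; intros.
      destruct Qdec; ring.
    + transitivity (csum I (fun U => csum I (fun V => csum I (fun P => csum I (fun R => 
      if Qdec (addQ U V) Q then Cmul (Cmul (a P) (smon phi P 0 U)) (Cmul (b R) (smon phi R 0 V)) else C0))))).
      * rewrite (lsum_ext I _ (fun P => csum I (fun U => csum I (fun R => csum I (fun V =>
          if Qdec (addQ U V) Q then Cmul (Cmul (a P) (smon phi P 0 U)) (Cmul (b R) (smon phi R 0 V)) else C0)))))
          by (intros; apply lsum_exchange).
        rewrite lsum_exchange; apply lsum_ext; intros U HU.
        rewrite (lsum_ext I _ (fun P => csum I (fun V => csum I (fun R =>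
          if Qdec (addQ U V) Q then Cmul (Cmul (a P) (smon phi P 0 U)) (Cmul (b R) (smon phi R 0 V)) else C0))))
          by (intros; apply lsum_exchange).
        apply lsum_exchange.
      * apply lsum_ext; intros U HU; apply lsum_ext; intros V HV; apply in_multi_le in HU, HV.
        destruct Qdec.
        -- rewrite !(scompE n N _ phi) by tauto. fold I. rewrite csum_scal_r; apply lsum_ext; intros.
           rewrite csum_scal; reflexivity.
        -- apply lsum_zero; intros; apply lsum_zero; auto.
Qed.

Lemma scomp_sone n phi : fixes0 n phi -> sereq n (scomp n sone phi) sone.
Proof.
  intros H0 Q HQ; rewrite (scompE n (sumQ Q)) by auto; rewrite (lsum_delta _ (zeroQ n)).
  - rewrite (smon_0 n) by auto; rewrite (soneE n) by apply repeat_length; destruct Qdec; [ring|congruence].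
  - apply NoDup_multi_le.
  - apply in_multi_le; rewrite zeroQ_sum, repeat_length; split; lia.
  - intros P HP Hn; apply in_multi_le in HP; rewrite (soneE n) by tauto; destruct Qdec; [congruence|ring].
Qed.

Lemma fixes0_comp n F G : fixes0 n F -> fixes0 n G -> fixes0 n (fcomp n F G).
Proof.
  intros HF HG i Hi; unfold fcomp; rewrite (scompE n 0); auto using repeat_length.
  - apply lsum_zero; intros P HP; apply in_multi_le in HP.
    replace P with (zeroQ n); [rewrite HF by auto; ring|].
    destruct HP as [HP H]; rewrite <- HP; symmetry; apply sumQ_0; lia.
  - rewrite zeroQ_sum; auto.
Qed.

Lemma smon_comp n G H P : fixes0 n G -> fixes0 n H -> length P = n ->
  sereq n (scomp n (smon G P 0) H) (smon (fcomp n G H) P 0).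
Proof.
  intros HG HH; revert P; apply midx_ind.
  - rewrite !smon_0. now apply scomp_sone.
  - intros i P Hi HP IH.
    now rewrite !smon_step, scomp_smul, IH by auto.
Qed.

Lemma fcomp_assoc n F G H : fixes0 n G -> fixes0 n H ->
  feq n (fcomp n (fcomp n F G) H) (fcomp n F (fcomp n G H)).
Proof.
  intros HG HH i Hi Q HQ; unfold fcomp at 1 3.
  set (N := sumQ Q).
  rewrite !(scompE n N) by (auto using fixes0_comp; unfold N; lia).
  transitivity (csum (multi_le n N) (fun P => csum (multi_le n N) (fun R =>
     Cmul (F i R) (Cmul (smon G R 0 P) (smon H P 0 Q))))).
  - apply lsum_ext; intros P HP; apply in_multi_le in HP; unfold fcomp.
    rewrite (scompE n N), csum_scal_r by tauto; apply lsum_ext; intros; ring.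
  - rewrite lsum_exchange; apply lsum_ext; intros R HR; apply in_multi_le in HR.
    rewrite <- (smon_comp n G H R), (scompE n N) by (tauto || (unfold N; lia)).
    rewrite csum_scal; reflexivity.
Qed.

Definition sadd (a b : series) : series := fun Q => Cadd (a Q) (b Q).
Definition sscal (c : cplx) (a : series) : series := fun Q => Cmul c (a Q).
Definition fadd (F G : fmap) : fmap := fun i => sadd (F i) (G i).
Definition fscal (c : cplx) (F : fmap) : fmap := fun i => sscal c (F i).

Lemma scomp_sadd n a b phi Q : scomp n (sadd a b) phi Q = Cadd (scomp n a phi Q) (scomp n b phi Q).
Proof.
  unfold scomp; rewrite !CsumE, <- lsum_add. apply lsum_ext; intros; unfold sadd; ring.
Qed.

Lemma scomp_sscal n c a phi Q : scomp n (sscal c a) phi Q = Cmul c (scomp n a phi Q).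
Proof.
  unfold scomp; rewrite !CsumE, csum_scal. apply lsum_ext; intros; unfold sscal; ring.
Qed.

Definition diagmap (n : nat) (c : nat -> cplx) : fmap := fun i => sscal (c i) (fid n i).

Lemma fidE n i j : (i < n)%nat -> fid n i (unitv n j) = if Nat.eq_dec i j then C1 else C0.
Proof.
  intros Hi; unfold fid; destruct list_eq_dec as [E|E], Nat.eq_dec; auto.
  - symmetry in E; apply unitv_inj in E; congruence.
  - congruence.
Qed.

Lemma fid_fixes0 n : fixes0 n (fid n).
Proof.
  intros i Hi; unfold fid; destruct list_eq_dec as [E|]; auto.
  apply (f_equal sumQ) in E; rewrite zeroQ_sum, unitv_sum in E; [lia|auto].
Qed.

Lemma scomp_fid n i phi : fixes0 n phi -> (i < n)%nat -> sereq n (scomp n (fid n i) phi) (phi i).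
Proof.
  intros H0 Hi Q HQ; rewrite (scompE n (S (sumQ Q))) by auto.
  rewrite (lsum_delta _ (unitv n i)).
  - rewrite (smon_unitv n), Nat.add_0_r, fidE by auto. destruct Nat.eq_dec; [ring|congruence].
  - apply NoDup_multi_le.
  - apply in_multi_le; rewrite unitv_length, unitv_sum by auto; split; lia.
  - intros P HP Hn; unfold fid; destruct list_eq_dec; [congruence|ring].
Qed.

Lemma fcomp_diag_l n c phi : fixes0 n phi ->
  feq n (fcomp n (diagmap n c) phi) (fun i => sscal (c i) (phi i)).
Proof. intros H i Hi Q HQ; unfold fcomp, diagmap; rewrite scomp_sscal, (scomp_fid n i phi); auto. Qed.

Lemma fcomp_fid_l n phi : fixes0 n phi -> feq n (fcomp n (fid n) phi) phi.
Proof. intros H i Hi; apply scomp_fid; auto. Qed.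

Lemma diagmap_fixes0 n c : fixes0 n (diagmap n c).
Proof. intros i Hi; unfold diagmap, sscal; rewrite fid_fixes0 by auto; ring. Qed.

Lemma Cmon_add c P R i : length P = length R ->
  Cmon c (addQ P R) i = Cmul (Cmon c P i) (Cmon c R i).
Proof.
  revert R i; induction P as [|p P IH]; intros [|r R]; simpl; intros i H; try lia; [ring|].
  rewrite IH by lia.
  assert (forall z q, Cpow z (p + q) = Cmul (Cpow z p) (Cpow z q)) as ->; [|ring].
  intros z q; induction p; simpl; [ring|rewrite IHp; ring].
Qed.

Lemma Cmon_0 c n i : Cmon c (zeroQ n) i = C1.
Proof. revert i; induction n; simpl; intros; auto. rewrite IHn; ring. Qed.

Lemma Cmon_unitv c n j i : (j < n)%nat -> Cmon c (unitv n j) i = c (j + i)%nat.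
Proof.
  revert j i; induction n; intros j i H; [lia|]; destruct j.
  - rewrite unitv_O; simpl; rewrite Cmon_0; simpl; ring.
  - rewrite unitv_S; simpl; rewrite IHn by lia. replace (j + S i)%nat with (S (j + i)) by lia; ring.
Qed.

Lemma smon_diag n c P : length P = n ->
  sereq n (smon (diagmap n c) P 0) (fun Q => if Qdec P Q then Cmon c P 0 else C0).
Proof.
  revert P; apply midx_ind.
  - rewrite smon_0; intros Q HQ; rewrite (soneE n), Cmon_0 by auto.
    destruct (Qdec Q _), (Qdec _ Q); congruence.
  - intros i P Hi HP IH; rewrite smon_step, IH by auto. intros Q HQ.
    rewrite Cmon_add, Cmon_unitv, Nat.add_0_r by (rewrite ?unitv_length; auto).
    destruct (Qdec _ Q) as [E|E].
    + rewrite (smulE n (sumQ Q)) by auto.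
      assert (sumQ Q = 1 + sumQ P)%nat as HS.
      { rewrite <- E, addQ_sum, unitv_sum; rewrite ?unitv_length; auto. }
      rewrite (lsum_delta _ (unitv n i)).
      * rewrite (lsum_delta _ P).
        -- destruct Qdec; [|congruence]. unfold diagmap, sscal; rewrite fidE by auto.
           destruct Nat.eq_dec; [|congruence]. destruct Qdec; [ring|congruence].
        -- apply NoDup_multi_le.
        -- apply in_multi_le; lia.
        -- intros R HR Hn; destruct (Qdec P R); [congruence|]. destruct Qdec; auto; ring.
      * apply NoDup_multi_le.
      * apply in_multi_le; rewrite unitv_length, unitv_sum by auto; lia.
      * intros R HR Hn; apply lsum_zero; intros; unfold diagmap, sscal, fid.
        destruct list_eq_dec; [congruence|]. destruct (Qdec _ Q); auto; ring.
    + rewrite (smulE n (sumQ Q)) by auto. apply lsum_zero; intros U HU; apply lsum_zero; intros V HV.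
      destruct (Qdec _ Q) as [E'|]; auto. unfold diagmap, sscal, fid.
      destruct list_eq_dec; [|ring]. destruct Qdec; [congruence|ring].
Qed.

(** Set against [fcomp_diag_l], which multiplies component j by its eigenvalue, this is the source
    of the divisors Lambda^Q - lambda_j. *)
Lemma scomp_diag n c g Q : length Q = n -> scomp n g (diagmap n c) Q = Cmul (g Q) (Cmon c Q 0).
Proof.
  intros HQ; rewrite (scompE n (sumQ Q)) by auto using diagmap_fixes0.
  rewrite (lsum_delta _ Q).
  - rewrite (smon_diag n c Q HQ Q HQ); destruct Qdec; congruence.
  - apply NoDup_multi_le.
  - apply in_multi_le; auto.
  - intros P HP Hn; apply in_multi_le in HP; rewrite (smon_diag n c P (proj1 HP) Q HQ).
    destruct Qdec; [congruence|ring].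
Qed.

Lemma Cpow_1 k : Cpow C1 k = C1.
Proof. induction k; simpl; auto; rewrite IHk; ring. Qed.

Lemma fid_diag n : feq n (fid n) (diagmap n (fun _ => C1)).
Proof. intros i Hi Q HQ; unfold diagmap, sscal; ring. Qed.

Lemma fcomp_fid_r n F : feq n (fcomp n F (fid n)) F.
Proof.
  rewrite fid_diag; intros i Hi Q HQ; unfold fcomp; rewrite scomp_diag by auto.
  assert (forall i, Cmon (fun _ => C1) Q i = C1) as ->; [|ring].
  clear; induction Q; simpl; intros; auto; rewrite IHQ, Cpow_1; ring.
Qed.

(** * Linear parts *)

Definition linmap (n : nat) (A : nat -> nat -> cplx) : fmap :=
  fun i Q => csum (seq 0 n) (fun j => Cmul (A i j) (fid n j Q)).

Lemma linmap_unitv n A i j : (j < n)%nat -> linmap n A i (unitv n j) = A i j.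
Proof.
  intros Hj; unfold linmap; rewrite (lsum_delta _ j).
  - rewrite fidE by auto; destruct Nat.eq_dec; [ring|congruence].
  - apply seq_NoDup.
  - apply in_seq; lia.
  - intros x Hx Hn; apply in_seq in Hx; rewrite fidE by lia; destruct Nat.eq_dec; [congruence|ring].
Qed.

Lemma linmap_linear n A : is_linear n (linmap n A).
Proof.
  intros i Hi Q HQ Hs; apply lsum_zero; intros j Hj; apply in_seq in Hj.
  unfold fid; destruct list_eq_dec as [->|]; [|ring]. destruct Hs; apply unitv_sum; lia.
Qed.

Lemma linear_ext n F G : is_linear n F -> is_linear n G ->
  mxeq n (linpart n F) (linpart n G) -> feq n F G.
Proof.
  intros HF HG H i Hi Q HQ; destruct (Nat.eq_dec (sumQ Q) 1) as [E|E].
  - destruct (sumQ_1 n Q HQ E) as (j & Hj & ->); apply H; auto.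
  - rewrite HF, HG; auto.
Qed.

Lemma is_linear_ext n F G : feq n F G -> is_linear n F -> is_linear n G.
Proof. intros H HF i Hi Q HQ Hs; rewrite <- H; auto. Qed.

#[global] Instance is_linear_proper n : Proper (feq n ==> iff) (is_linear n).
Proof. intros F G H; split; apply is_linear_ext; [auto|now symmetry]. Qed.

Lemma is_linear_fixes0 n F : is_linear n F -> fixes0 n F.
Proof. intros H i Hi; apply H; auto using repeat_length. rewrite zeroQ_sum; lia. Qed.

Lemma linmap_ext n A B : mxeq n A B -> feq n (linmap n A) (linmap n B).
Proof.
  intros H i Hi Q HQ; apply lsum_ext; intros j Hj; apply in_seq in Hj; rewrite H; auto; lia.
Qed.

Lemma linmap_linpart n F : is_linear n F -> feq n F (linmap n (linpart n F)).
Proof.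
  intros H; apply linear_ext; auto using linmap_linear.
  intros i j Hi Hj; unfold linpart at 2; now rewrite linmap_unitv.
Qed.

Lemma scomp_linmap n A i phi : fixes0 n phi ->
  sereq n (scomp n (linmap n A i) phi) (fun Q => csum (seq 0 n) (fun j => Cmul (A i j) (phi j Q))).
Proof.
  intros H0 Q HQ; unfold scomp.
  transitivity (csum (multi_le n (sumQ Q)) (fun P => csum (seq 0 n) (fun j =>
    Cmul (A i j) (Cmul (fid n j P) (smon phi P 0 Q))))).
  - apply lsum_ext; intros P HP; unfold linmap; rewrite csum_scal_r; apply lsum_ext; intros; ring.
  - rewrite lsum_exchange; apply lsum_ext; intros j Hj; apply in_seq in Hj.
    rewrite <- (scomp_fid n j phi) by (auto; lia).
    unfold scomp; rewrite CsumE, csum_scal; apply lsum_ext; intros; reflexivity.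
Qed.

Lemma smon_unit_coef n phi P j : fixes0 n phi -> length P = n -> (j < n)%nat -> sumQ P <> 1%nat ->
  smon phi P 0 (unitv n j) = C0.
Proof.
  intros H0 HP Hj Hs; destruct (Nat.eq_dec (sumQ P) 0) as [E|E].
  - apply sumQ_0 in E; rewrite HP in E; subst P; rewrite (smon_0 n), (soneE n); auto using unitv_length.
    destruct Qdec as [E|]; auto. apply (f_equal sumQ) in E; rewrite zeroQ_sum, unitv_sum in E; [lia|auto].
  - apply (smon_order n); auto using unitv_length. rewrite unitv_sum by auto; lia.
Qed.

Lemma linpart_comp n F G : fixes0 n G ->
  mxeq n (linpart n (fcomp n F G)) (matmul n (linpart n F) (linpart n G)).
Proof.
  intros H0 i j Hi Hj; unfold linpart at 1, fcomp.
  transitivity (scomp n (linmap n (linpart n F) i) G (unitv n j)).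
  - rewrite !(scompE n 1) by (rewrite ?unitv_sum; auto using unitv_length).
    apply lsum_ext; intros P HP; apply in_multi_le in HP.
    destruct (Nat.eq_dec (sumQ P) 1) as [E|E].
    + destruct (sumQ_1 n P) as (l & Hl & ->); try tauto; rewrite linmap_unitv; auto.
    + rewrite smon_unit_coef by tauto; ring.
  - rewrite scomp_linmap by auto using unitv_length; reflexivity.
Qed.

Lemma linmap_comp n A B : feq n (fcomp n (linmap n A) (linmap n B)) (linmap n (matmul n A B)).
Proof.
  intros i Hi Q HQ; unfold fcomp.
  rewrite scomp_linmap by auto using is_linear_fixes0, linmap_linear.
  unfold linmap, matmul.
  transitivity (csum (seq 0 n) (fun l => csum (seq 0 n) (fun j => Cmul (Cmul (A i l) (B l j)) (fid n j Q)))).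
  - apply lsum_ext; intros; rewrite csum_scal; apply lsum_ext; intros; ring.
  - rewrite lsum_exchange; apply lsum_ext; intros; symmetry; apply csum_scal_r.
Qed.

Lemma linmap_id n A : mxeq n A idmx -> feq n (linmap n A) (fid n).
Proof.
  intros H; rewrite (linmap_ext n A idmx H). intros i Hi Q HQ; unfold linmap.
  rewrite (lsum_delta _ i).
  - unfold idmx; rewrite Nat.eqb_refl; ring.
  - apply seq_NoDup.
  - apply in_seq; lia.
  - intros j Hj Hn; unfold idmx; destruct (Nat.eqb_spec i j); [congruence|ring].
Qed.

(** The linear part is kept as a map and not as a matrix, so that it can be composed and rewritten
    together with nonlinear maps; [linop_comp] is then the chain rule at 0. *)
Definition linop (n : nat) (F : fmap) : fmap := linmap n (linpart n F).

#[global] Instance linop_proper n : Proper (feq n ==> feq n) (linop n).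
Proof.
  intros F G H; apply linmap_ext; intros i j Hi Hj; unfold linpart; apply H; auto using unitv_length.
Qed.

Lemma linop_comp n F G : fixes0 n G -> feq n (linop n (fcomp n F G)) (fcomp n (linop n F) (linop n G)).
Proof. intros H; unfold linop; rewrite linmap_comp; apply linmap_ext, linpart_comp; auto. Qed.

Lemma linop_linear n F : is_linear n F -> feq n (linop n F) F.
Proof. intros H; symmetry; apply linmap_linpart, H. Qed.

Lemma diagmap_linear n c : is_linear n (diagmap n c).
Proof.
  intros i Hi Q HQ Hs; unfold diagmap, sscal, fid; destruct list_eq_dec as [->|]; [|ring].
  destruct Hs; apply unitv_sum; auto.
Qed.

Lemma fid_linear n : is_linear n (fid n).
Proof. rewrite fid_diag; apply diagmap_linear. Qed.

Lemma linop_fid n : feq n (linop n (fid n)) (fid n).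
Proof. apply linop_linear, fid_linear. Qed.

Lemma linmap_diag n P c : feq n (linmap n (fun i j => Cmul (P i j) (c j))) (fcomp n (linmap n P) (diagmap n c)).
Proof.
  intros i Hi Q HQ; unfold fcomp; rewrite scomp_linmap by auto using diagmap_fixes0.
  apply lsum_ext; intros; unfold diagmap, sscal; ring.
Qed.

#[global] Hint Resolve fid_fixes0 fixes0_comp is_linear_fixes0 linmap_linear diagmap_fixes0 : fix0.

Lemma linop_fixes0 n F : fixes0 n (linop n F).
Proof. apply is_linear_fixes0, linmap_linear. Qed.
#[global] Hint Resolve linop_fixes0 : fix0.

(** * Norm estimates *)

Lemma Cnorm_ge0 z : 0 <= Cnorm z.
Proof. apply sqrt_pos. Qed.
#[global] Hint Resolve Cnorm_ge0 : core.

Lemma Cnorm_0 : Cnorm C0 = 0.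
Proof. unfold Cnorm; simpl; replace (0 * 0 + 0 * 0) with 0 by ring; apply sqrt_0. Qed.

Lemma Cnorm_eq0 z : Cnorm z = 0 -> z = C0.
Proof.
  intros H; apply sqrt_eq_0 in H; [|nra]. apply cplx_eq; simpl; nra.
Qed.

Lemma Cnorm_real x : 0 <= x -> Cnorm (x, 0) = x.
Proof. intros H; unfold Cnorm; simpl; rewrite Rmult_0_l, Rplus_0_r; apply sqrt_square, H. Qed.

Lemma Cnorm_1 : Cnorm C1 = 1.
Proof. apply Cnorm_real; lra. Qed.

Lemma Cnorm_mul z w : Cnorm (Cmul z w) = Cnorm z * Cnorm w.
Proof. unfold Cnorm; rewrite <- sqrt_mult by nra; f_equal; simpl; ring. Qed.

Lemma Cnorm_triangle z w : Cnorm (Cadd z w) <= Cnorm z + Cnorm w.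
Proof.
  (* The plane triangle with vertices z + w, 0 and w. *)
  pose proof (triangle (fst z + fst w) (snd z + snd w) 0 0 (fst w) (snd w)) as H.
  unfold dist_euc, Rsqr in H; unfold Cnorm; simpl.
  replace (fst z + fst w - fst w) with (fst z) in H by ring.
  replace (snd z + snd w - snd w) with (snd z) in H by ring.
  rewrite !Rminus_0_r in H; exact H.
Qed.

Lemma Cnorm_opp z : Cnorm (Copp z) = Cnorm z.
Proof. unfold Cnorm; simpl; f_equal; ring. Qed.

Lemma Cnorm_sub z w : Cnorm (Csub z w) <= Cnorm z + Cnorm w.
Proof. unfold Csub; rewrite <- (Cnorm_opp w); apply Cnorm_triangle. Qed.

Lemma Cmul_integral z w : Cmul z w = C0 -> z = C0 \/ w = C0.
Proof.
  intros H; apply (f_equal Cnorm) in H; rewrite Cnorm_mul, Cnorm_0 in H.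
  apply Rmult_integral in H; destruct H; [left|right]; apply Cnorm_eq0; auto.
Qed.

Lemma rsum_cons {I} x (l : list I) F : rsum (x :: l) F = F x + rsum l F.
Proof. reflexivity. Qed.

Lemma rsum_le {I} (l : list I) F G : (forall x, In x l -> F x <= G x) -> rsum l F <= rsum l G.
Proof.
  induction l as [|x l IH]; intros H; [simpl; unfold lsum; simpl; lra|].
  rewrite !rsum_cons. apply Rplus_le_compat; [apply H; simpl; auto|apply IH; intros; apply H; simpl; auto].
Qed.

Lemma rsum_ge0 {I} (l : list I) F : (forall x, In x l -> 0 <= F x) -> 0 <= rsum l F.
Proof.
  intros H; replace 0 with (rsum l (fun _ => 0)) at 1 by (now apply lsum_zero). apply rsum_le, H.
Qed.

Lemma rsum_scal {I} (l : list I) c F : c * rsum l F = rsum l (fun x => c * F x).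
Proof. apply (lsum_hom (Rmult c)); intros; ring. Qed.

Lemma rsum_scal_r {I} (l : list I) c F : rsum l F * c = rsum l (fun x => F x * c).
Proof. apply (lsum_hom (fun x => x * c)); intros; ring. Qed.

Lemma rsum_const {I} (l : list I) c : rsum l (fun _ => c) = INR (length l) * c.
Proof.
  induction l; [unfold lsum; simpl; ring|]. rewrite rsum_cons, IHl; simpl length; rewrite S_INR; ring.
Qed.

Lemma rsum_term {I} (l : list I) F x :
  (forall y, In y l -> 0 <= F y) -> In x l -> F x <= rsum l F.
Proof.
  induction l as [|y l IH]; intros H Hx; [destruct Hx|]; rewrite rsum_cons.
  assert (0 <= rsum l F) by (apply rsum_ge0; intros; apply H; simpl; auto).
  assert (0 <= F y) by (apply H; simpl; auto).
  destruct Hx as [->|Hx]; [lra|]. assert (F x <= rsum l F); [|lra].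
  apply IH; auto. intros; apply H; simpl; auto.
Qed.

Lemma Cnorm_csum {I} (l : list I) F : Cnorm (csum l F) <= rsum l (fun x => Cnorm (F x)).
Proof.
  induction l as [|x l IH]; [unfold lsum; simpl; rewrite Cnorm_0; lra|].
  rewrite rsum_cons; eapply Rle_trans; [apply Cnorm_triangle|]. apply Rplus_le_compat_l, IH.
Qed.

(** A truncated product of n geometric series, each with sum at most 2. Uniformity in [B] stands in
    for the convergence of the multiple series. *)
Lemma rsum_geometric n B y : 0 <= y <= 1 / 2 ->
  rsum (multi_le n B) (fun Q => y ^ sumQ Q) <= 2 ^ n.
Proof.
  intros Hy; revert B; induction n; intros B; [unfold lsum; simpl; lra|].
  change (multi_le (S n) B) with
      (flat_map (fun i => map (cons i) (multi_le n (B - i))) (seq 0 (S B))).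
  assert (forall l : list nat, rsum (flat_map (fun i => map (cons i) (multi_le n (B - i))) l) 
    (fun Q => y ^ sumQ Q) <= rsum l (fun i => y ^ i) * 2 ^ n) as H.
  { induction l as [|i l IH]; [unfold lsum; simpl; lra|].
    simpl flat_map; rewrite lsum_app, rsum_cons, Rmult_plus_distr_r. apply Rplus_le_compat; auto.
    unfold lsum at 1; rewrite map_map.
    change (rsum (multi_le n (B - i)) (fun Q => y ^ (i + sumQ Q)) <= y ^ i * 2 ^ n).
    rewrite (lsum_ext _ _ (fun Q => y ^ i * y ^ sumQ Q)) by (intros; apply pow_add).
    rewrite <- rsum_scal. apply Rmult_le_compat_l; auto. apply pow_le; lra. }
  eapply Rle_trans; [apply H|]. simpl; apply Rmult_le_compat_r; [apply pow_le; lra|].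
  assert (forall k a, rsum (seq a k) (fun i => y ^ i) <= 2 * y ^ a) as Hk.
  { induction k; intros a.
    - assert (0 <= y ^ a) by (apply pow_le; lra). unfold lsum; simpl; lra.
    - change (y ^ a + rsum (seq (S a) k) (fun i => y ^ i) <= 2 * y ^ a).
      specialize (IHk (S a)); simpl in IHk.
      assert (0 <= y ^ a) by (apply pow_le; lra). nra. }
  specialize (Hk (S B) 0%nat); simpl in *; lra.
Qed.

(** Weighted l1 norm of the truncation at degree [B]. The weight is an arbitrary function of Q,
    since the small divisors are to be absorbed in it. *)
Definition wnorm (n B : nat) (W : list nat -> R) (a : series) : R :=
  rsum (multi_le n B) (fun Q => Cnorm (a Q) * W Q).

Lemma wnorm_ge0 n B W a : (forall Q, 0 <= W Q) -> 0 <= wnorm n B W a.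
Proof. intros H; apply rsum_ge0; intros; apply Rmult_le_pos; auto. Qed.

Lemma wnorm_ext n B W a b : sereq n a b -> wnorm n B W a = wnorm n B W b.
Proof. intros H; apply lsum_ext; intros Q HQ; apply in_multi_le in HQ; rewrite H; tauto. Qed.

(** The product is measured with [V] and the factors with [W], which leaves room for a gain. The
    condition on the weights is asked only where both coefficients are nonzero: for factors without
    constant term it then concerns nonzero P and R only, as in the inequalities for [K]. *)
Lemma wnorm_smul n B V W a b :
  (forall Q, 0 <= V Q) -> (forall Q, 0 <= W Q) ->
  (forall P R, length P = n -> length R = n -> (sumQ (addQ P R) <= B)%nat ->
     a P <> C0 -> b R <> C0 -> V (addQ P R) <= W P * W R) ->
  wnorm n B V (smul a b) <= wnorm n B W a * wnorm n B W b.
Proof.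
  intros HV HW H; unfold wnorm; set (I := multi_le n B).
  apply Rle_trans with (rsum I (fun Q => rsum I (fun P => rsum I (fun R =>
    if Qdec (addQ P R) Q then Cnorm (a P) * Cnorm (b R) * V Q else 0)))).
  - apply rsum_le; intros Q HQ; apply in_multi_le in HQ; rewrite (smulE n B) by tauto.
    eapply Rle_trans; [apply Rmult_le_compat_r, Cnorm_csum; auto|].
    rewrite rsum_scal_r; apply rsum_le; intros P HP.
    eapply Rle_trans; [apply Rmult_le_compat_r, Cnorm_csum; auto|].
    rewrite rsum_scal_r; apply rsum_le; intros R HR.
    destruct Qdec; [rewrite Cnorm_mul|rewrite Cnorm_0]; lra.
  - rewrite lsum_exchange, rsum_scal_r; apply rsum_le; intros P HP.
    rewrite lsum_exchange, rsum_scal; apply rsum_le; intros R HR.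
    apply in_multi_le in HP, HR.
    assert (0 <= Cnorm (a P) * W P * (Cnorm (b R) * W R)) as H0
      by (repeat apply Rmult_le_pos; auto).
    destruct (le_lt_dec (sumQ (addQ P R)) B) as [Hs|Hs].
    + rewrite (lsum_delta _ (addQ P R)).
      * destruct Qdec; [|congruence].
        destruct (Ceq_dec (a P) C0) as [E|E]; [rewrite E, Cnorm_0 in *; lra|].
        destruct (Ceq_dec (b R) C0) as [E'|E']; [rewrite E', Cnorm_0 in *; lra|].
        replace (Cnorm (a P) * W P * (Cnorm (b R) * W R)) with 
          (Cnorm (a P) * Cnorm (b R) * (W P * W R)) by ring.
        apply Rmult_le_compat_l; [apply Rmult_le_pos; auto|]. apply H; tauto.
      * apply NoDup_multi_le.
      * apply in_multi_le; split; auto; apply addQ_length; tauto.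
      * intros; destruct Qdec; congruence.
    + rewrite lsum_zero; auto.
      intros Q HQ; apply in_multi_le in HQ; destruct Qdec; auto; subst; lia.
Qed.

Lemma addQ_zero_r n P : length P = n -> addQ P (zeroQ n) = P.
Proof. intros <-; apply addQ_0. Qed.

Lemma fixes0_nz n phi i P : fixes0 n phi -> (i < n)%nat -> phi i P <> C0 -> P <> zeroQ n.
Proof. intros H0 Hi H ->; auto. Qed.

Lemma wnorm_smon n B W phi s P :
  fixes0 n phi -> (forall Q, 0 <= W Q) -> W (zeroQ n) = 1 ->
  (forall P R, length P = n -> length R = n -> (sumQ (addQ P R) <= B)%nat ->
     P <> zeroQ n -> R <> zeroQ n -> W (addQ P R) <= W P * W R) ->
  (forall i, (i < n)%nat -> wnorm n B W (phi i) <= s) ->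
  length P = n -> wnorm n B W (smon phi P 0) <= s ^ sumQ P.
Proof.
  intros H0 HW HW0 HM Hs; revert P; apply midx_ind.
  - rewrite zeroQ_sum, (wnorm_ext _ _ _ _ sone) by apply smon_0; simpl.
    unfold wnorm; rewrite (lsum_delta _ (zeroQ n)).
    + rewrite (soneE n), HW0 by apply repeat_length; destruct Qdec; [rewrite Cnorm_1; lra|congruence].
    + apply NoDup_multi_le.
    + apply in_multi_le; rewrite repeat_length, zeroQ_sum; split; lia.
    + intros Q HQ Hn; apply in_multi_le in HQ; rewrite (soneE n) by tauto.
      destruct Qdec; [congruence|rewrite Cnorm_0; ring].
  - intros i P Hi HP IH. rewrite (wnorm_ext _ _ _ _ _ (smon_step n phi i P Hi HP)).
    rewrite addQ_sum, unitv_sum by (rewrite ?unitv_length; auto); simpl.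
    apply Rle_trans with (wnorm n B W (phi i) * wnorm n B W (smon phi P 0)).
    + apply wnorm_smul; auto. intros U R HU HR Hl Hn _; apply fixes0_nz with (n := n) in Hn; auto.
      destruct (Qdec R (zeroQ n)) as [->|HR0]; auto.
      rewrite addQ_zero_r, HW0 by auto; lra.
    + apply Rmult_le_compat; auto using wnorm_ge0.
Qed.

(** The gain requires a product of two series without constant term. As |P| >= 2, such a product is
    phi_i times phi^P' with P' nonzero. The gain is taken once, in this outermost product, because
    each coefficient equation carries one divisor. *)
Lemma wnorm_smon_gain n B V W phi s P :
  fixes0 n phi -> (forall Q, 0 <= V Q) -> (forall Q, 0 <= W Q) -> W (zeroQ n) = 1 ->
  (forall P R, length P = n -> length R = n -> (sumQ (addQ P R) <= B)%nat ->
     P <> zeroQ n -> R <> zeroQ n -> W (addQ P R) <= W P * W R /\ V (addQ P R) <= W P * W R) ->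
  (forall i, (i < n)%nat -> wnorm n B W (phi i) <= s) ->
  length P = n -> (2 <= sumQ P)%nat -> wnorm n B V (smon phi P 0) <= s ^ sumQ P.
Proof.
  intros H0 HV HW HW0 HM Hs HP H2.
  destruct (midx_cases n P HP) as [->|(i & P' & Hi & HP' & ->)].
  { rewrite zeroQ_sum in H2; lia. }
  rewrite (wnorm_ext _ _ _ _ _ (smon_step n phi i P' Hi HP')).
  rewrite addQ_sum, unitv_sum in * by (rewrite ?unitv_length; auto); simpl.
  apply Rle_trans with (wnorm n B W (phi i) * wnorm n B W (smon phi P' 0)).
  - apply wnorm_smul; auto. intros U R HU HR Hl Hn HR0; apply fixes0_nz with (n := n) in Hn; auto.
    apply HM; auto. intros ->; apply HR0, (smon_order n); auto. rewrite zeroQ_sum; lia.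
  - apply Rmult_le_compat; auto using wnorm_ge0. apply wnorm_smon; auto. intros; apply HM; auto.
Qed.

Lemma wnorm_scomp n B V g phi s :
  fixes0 n phi -> (forall Q, 0 <= V Q) ->
  (forall P, length P = n -> g P <> C0 -> wnorm n B V (smon phi P 0) <= s ^ sumQ P) ->
  wnorm n B V (scomp n g phi) <= rsum (multi_le n B) (fun P => Cnorm (g P) * s ^ sumQ P).
Proof.
  intros H0 HV H. unfold wnorm at 1.
  apply Rle_trans with (rsum (multi_le n B) (fun Q => rsum (multi_le n B) (fun P =>
    Cnorm (g P) * (Cnorm (smon phi P 0 Q) * V Q)))).
  - apply rsum_le; intros Q HQ; apply in_multi_le in HQ; rewrite (scompE n B) by tauto.
    eapply Rle_trans; [apply Rmult_le_compat_r, Cnorm_csum; auto|].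
    rewrite rsum_scal_r; apply rsum_le; intros P HP; rewrite Cnorm_mul; lra.
  - rewrite lsum_exchange; apply rsum_le; intros P HP; apply in_multi_le in HP.
    rewrite <- rsum_scal. destruct (Ceq_dec (g P) C0) as [E|E].
    + rewrite E, Cnorm_0; lra.
    + apply Rmult_le_compat_l; auto. apply H; tauto.
Qed.

Lemma pow_le_geometric k m y : (m <= k)%nat -> 0 <= y <= 1 / 2 -> y ^ k <= (2 * y) ^ m * (1 / 2) ^ k.
Proof.
  intros Hk Hy. replace k with (m + (k - m))%nat by lia. rewrite !pow_add, <- Rmult_assoc, <- Rpow_mult_distr.
  replace (2 * y * (1 / 2)) with y by field.
  apply Rmult_le_compat_l; [apply pow_le; lra|]. apply pow_incr; lra.
Qed.

(** Shrinking the radius by y gains a factor (2y)^m for a series of order m. The case m = 2 makes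
    the remainder quadratically small; m = 1 and m = 0 serve for the composition of convergent
    maps. *)
Lemma rsum_order n B g rho M y m :
  0 <= rho -> 0 <= M -> 0 <= y <= 1 / 2 ->
  (forall P, length P = n -> Cnorm (g P) * rho ^ sumQ P <= M) ->
  (forall P, length P = n -> (sumQ P < m)%nat -> g P = C0) ->
  rsum (multi_le n B) (fun P => Cnorm (g P) * (y * rho) ^ sumQ P) <= M * (2 * y) ^ m * 2 ^ n.
Proof.
  intros Hr HM Hy Hg H0.
  apply Rle_trans with (rsum (multi_le n B) (fun P => M * (2 * y) ^ m * (1 / 2) ^ sumQ P)).
  - apply rsum_le; intros P HP; apply in_multi_le in HP.
    assert (0 <= (2 * y) ^ m * (1 / 2) ^ sumQ P) by (apply Rmult_le_pos; apply pow_le; lra).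
    destruct (le_lt_dec m (sumQ P)) as [Hs|Hs].
    + rewrite Rpow_mult_distr.
      replace (Cnorm (g P) * (y ^ sumQ P * rho ^ sumQ P)) with
        (Cnorm (g P) * rho ^ sumQ P * y ^ sumQ P) by ring.
      rewrite (Rmult_assoc M). apply Rmult_le_compat; auto using pow_le_geometric.
      * apply Rmult_le_pos; auto; apply pow_le; lra.
      * apply pow_le; lra.
      * apply Hg; tauto.
    + rewrite H0, Cnorm_0, Rmult_0_l by tauto. rewrite Rmult_assoc; apply Rmult_le_pos; auto.
  - rewrite <- rsum_scal. apply Rmult_le_compat_l.
    + apply Rmult_le_pos; auto; apply pow_le; lra.
    + apply rsum_geometric; lra.
Qed.

(** The weight [t^|Q| E Q] absorbs the small divisors [1 / D Q]: each product of two
    nonconstant series gains a factor [D], so the weighted norm of the truncations of [phi]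
    stays in the region where the quadratic remainder is a contraction. *)
Lemma majorant n h rho M : 0 < rho -> 0 <= M ->
  exists t s, 0 < t /\ forall B (E D : list nat -> R) (G : nat -> fmap) phi,
    fixes0 n phi ->
    (forall i j, (i < n)%nat -> (j < n)%nat -> Cnorm (phi i (unitv n j)) <= 1) ->
    (forall Q, 0 <= E Q) -> (forall Q, 0 <= D Q) -> E (zeroQ n) = 1 ->
    (forall j, (j < n)%nat -> E (unitv n j) <= 1) ->
    (forall P R, length P = n -> length R = n -> (sumQ (addQ P R) <= B)%nat ->
       P <> zeroQ n -> R <> zeroQ n ->
       E (addQ P R) <= E P * E R /\ D (addQ P R) * E (addQ P R) <= E P * E R) ->
    (forall k i P, (k < h)%nat -> (i < n)%nat -> length P = n -> Cnorm (G k i P) * rho ^ sumQ P <= M) ->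
    (forall k i P, (k < h)%nat -> (i < n)%nat -> length P = n -> (sumQ P < 2)%nat -> G k i P = C0) ->
    (forall i Q, (i < n)%nat -> length Q = n -> (2 <= sumQ Q <= B)%nat ->
       Cnorm (phi i Q) <= D Q * rsum (seq 0 h) (fun k => Cnorm (scomp n (G k i) phi Q))) ->
    forall i Q, (i < n)%nat -> length Q = n -> (sumQ Q <= B)%nat ->
      Cnorm (phi i Q) * (t ^ sumQ Q * E Q) <= s.
Proof.
  intros Hrho HM.
  set (A := 2 ^ n). assert (1 <= A) as HA by (apply pow_R1_Rle; lra).
  (* With s = y rho, the h remainders together are at most L y^2. The choice of [y] makes this at
     most s / 2, and the choice of [t] makes the linear terms contribute 2tA = s / 2, so the bound
     [s] reproduces itself. *)
  set (L := INR h * (4 * M * A)). assert (0 <= L) as HL.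
  { apply Rmult_le_pos; [apply pos_INR|]. apply Rmult_le_pos; lra. }
  set (y := Rmin (1 / 2) (rho / (2 * L + 1))).
  assert (0 < rho / (2 * L + 1)) as Hq by (apply Rdiv_lt_0_compat; lra).
  assert (0 < y) as Hy0 by (apply Rmin_glb_lt; lra).
  assert (y <= 1 / 2) as Hy1 by apply Rmin_l.
  assert (L * (y * y) <= y * rho / 2) as HLy.
  { assert (y * (2 * L + 1) <= rho) as H.
    { apply Rle_trans with (rho / (2 * L + 1) * (2 * L + 1)); [|right; field; lra].
      apply Rmult_le_compat_r; [lra|apply Rmin_r]. }
    nra. }
  set (s := y * rho). assert (0 < s) as Hs by (apply Rmult_lt_0_compat; lra).
  set (t := s / (4 * A)). assert (0 < t) as Ht by (apply Rdiv_lt_0_compat; lra).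
  exists t, s; split; auto.
  intros B E D G phi H0 H1 HE HD HE0 HE1 HED HG HG2 Hphi.
  (* The second cutoff [N] drives an induction: two nonzero indices of total degree at most N + 1
     both have degree at most N, so the remainder at stage N + 1 is controlled by the norm at stage
     N. *)
  set (W := fun N Q => if le_dec (sumQ Q) N then t ^ sumQ Q * E Q else 0).
  set (V := fun N Q => if le_dec (sumQ Q) N then D Q * (t ^ sumQ Q * E Q) else 0).
  assert (forall Q, 0 <= t ^ sumQ Q * E Q) as HW0 by (intros; apply Rmult_le_pos; auto; apply pow_le; lra).
  assert (forall N Q, 0 <= W N Q) as HW by (intros; unfold W; destruct le_dec; auto; lra).
  assert (forall N Q, 0 <= V N Q) as HV by (intros; unfold V; destruct le_dec; [apply Rmult_le_pos; auto|lra]).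
  assert (forall N, (N <= B)%nat -> forall i, (i < n)%nat -> wnorm n B (W N) (phi i) <= s) as Hmain.
  { induction N as [|N IH]; intros HN i Hi.
    - unfold wnorm; rewrite lsum_zero; [lra|]. intros Q HQ; apply in_multi_le in HQ.
      unfold W; destruct le_dec as [Hl|]; [|ring].
      rewrite (sumQ_0 Q) by lia; rewrite (proj1 HQ), H0, Cnorm_0 by auto; ring.
    (* The term 2t (1/2)^|Q| equals t in degree 1, where it pays for the linear part; keeping it in
       all degrees lets [rsum_geometric] sum it. *)
    - apply Rle_trans with (rsum (multi_le n B) (fun Q => 2 * t * (1 / 2) ^ sumQ Q +
        rsum (seq 0 h) (fun k => Cnorm (scomp n (G k i) phi Q) * V (S N) Q))).
      + apply rsum_le; intros Q HQ; apply in_multi_le in HQ.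
        assert (0 <= 2 * t * (1 / 2) ^ sumQ Q) as Ha by (apply Rmult_le_pos; [|apply pow_le]; lra).
        assert (0 <= rsum (seq 0 h) (fun k => Cnorm (scomp n (G k i) phi Q) * V (S N) Q)) as Hb.
        { apply rsum_ge0; intros; apply Rmult_le_pos; auto. }
        unfold W; destruct le_dec as [Hl|]; [|lra].
        destruct (Nat.eq_dec (sumQ Q) 0) as [E0|E0].
        { rewrite (sumQ_0 Q E0) at 1; rewrite (proj1 HQ), H0, Cnorm_0 by auto; lra. }
        destruct (Nat.eq_dec (sumQ Q) 1) as [E1|E1].
        { destruct (sumQ_1 n Q (proj1 HQ) E1) as (j & Hj & ->); rewrite E1 in *.
          apply Rle_trans with (1 * (t * 1)); [|simpl; lra]. rewrite pow_1 in *.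
          apply Rmult_le_compat; auto; [apply Rmult_le_pos; auto; lra|].
          apply Rmult_le_compat_l; [lra|auto]. }
        rewrite <- rsum_scal_r. unfold V; destruct le_dec; [|tauto].
        apply Rle_trans with (D Q * rsum (seq 0 h) (fun k => Cnorm (scomp n (G k i) phi Q)) *
          (t ^ sumQ Q * E Q)); [|lra].
        apply Rmult_le_compat_r; auto. apply Hphi; tauto || lia.
      + rewrite lsum_add, <- rsum_scal, lsum_exchange.
        apply Rle_trans with (2 * t * A + rsum (seq 0 h) (fun _ => M * (2 * y) ^ 2 * A)).
        * apply Rplus_le_compat.
          { apply Rmult_le_compat_l; [lra|]. apply rsum_geometric; lra. }
          { apply rsum_le; intros k Hk; apply in_seq in Hk.
            eapply Rle_trans; [apply (wnorm_scomp n B (V (S N)) (G k i) phi s); auto|].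
            - intros P HP HGP. apply wnorm_smon_gain with (W := W N); auto.
              + unfold W; rewrite zeroQ_sum; simpl; rewrite HE0; ring.
              + intros P' R HP' HR Hl HP0 HR0.
                destruct (HED P' R) as [He1 He2]; auto.
                apply sumQ_pos in HP0, HR0; auto.
                rewrite addQ_sum in Hl by lia.
                assert (forall e, e <= E P' * E R -> t ^ sumQ (addQ P' R) * e <=
                  t ^ sumQ P' * E P' * (t ^ sumQ R * E R)) as Hpow.
                { intros e He; rewrite addQ_sum, pow_add by lia.
                  replace (t ^ sumQ P' * E P' * (t ^ sumQ R * E R)) with
                    (t ^ sumQ P' * t ^ sumQ R * (E P' * E R)) by ring.
                  apply Rmult_le_compat_l; auto. apply Rmult_le_pos; apply pow_le; lra. }
                split.
                * unfold W at 1; destruct le_dec as [Hl'|]; [|apply Rmult_le_pos; auto].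
                  rewrite addQ_sum in Hl' by lia.
                  unfold W; destruct le_dec; [|lia]; destruct le_dec; [|lia]. apply Hpow; auto.
                * unfold V; destruct le_dec as [Hl'|]; [|apply Rmult_le_pos; auto].
                  rewrite addQ_sum in Hl' by lia.
                  unfold W; destruct le_dec; [|lia]; destruct le_dec; [|lia].
                  replace (D (addQ P' R) * (t ^ sumQ (addQ P' R) * E (addQ P' R))) with
                    (t ^ sumQ (addQ P' R) * (D (addQ P' R) * E (addQ P' R))) by ring.
                  apply Hpow; auto.
              + apply IH; lia.
              + destruct (le_lt_dec 2 (sumQ P)); auto. destruct HGP; apply HG2; auto; lia.
            - apply rsum_order; auto; try lra; intros; [apply HG|apply HG2]; auto; lia. }
        * rewrite rsum_const, length_seq.
          replace (2 * t * A) with (s / 2) by (unfold t; field; lra).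
          replace (INR h * (M * (2 * y) ^ 2 * A)) with (L * (y * y)) by (unfold L; ring).
          unfold s in *; lra. }
  intros i Q Hi HQ Hl.
  apply Rle_trans with (wnorm n B (W B) (phi i)); auto.
  apply Rle_trans with (Cnorm (phi i Q) * W B Q).
  - unfold W; destruct le_dec; [lra|tauto].
  - apply (rsum_term (multi_le n B) (fun Q => Cnorm (phi i Q) * W B Q)).
    + intros; apply Rmult_le_pos; auto.
    + apply in_multi_le; auto.
Qed.

(** * Convergent maps *)

(** Besides a common radius and bound, this supplies 0 <= M, which [convergent] does not state. *)
Lemma convergent_family n h (F : nat -> fmap) :
  (forall k, (k < h)%nat -> convergent n (F k)) ->
  exists r M, 0 < r /\ 0 <= M /\ forall k i Q, (k < h)%nat -> (i < n)%nat -> length Q = n ->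
    Cnorm (F k i Q) * r ^ sumQ Q <= M.
Proof.
  induction h as [|h IH]; intros H.
  - exists 1, 0; repeat split; intros; lra || lia.
  - destruct IH as (r & M & Hr & HM & HF); [auto|].
    destruct (H h (Nat.lt_succ_diag_r h)) as (r' & M' & Hr' & HF').
    exists (Rmin r r'), (Rmax M M'); repeat split.
    + apply Rmin_glb_lt; auto.
    + eapply Rle_trans; [apply HM|apply Rmax_l].
    + assert (0 < Rmin r r') as Hm by (apply Rmin_glb_lt; auto).
      intros k i Q Hk Hi HQ; destruct (Nat.eq_dec k h) as [->|Hn].
      * eapply Rle_trans; [|apply Rmax_r]. eapply Rle_trans; [|apply (HF' i Hi Q HQ)].
        apply Rmult_le_compat_l; auto. apply pow_incr; split; [lra|apply Rmin_r].
      * eapply Rle_trans; [|apply Rmax_l]. eapply Rle_trans; [|apply (HF k i Q); auto; lia].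
        apply Rmult_le_compat_l; auto. apply pow_incr; split; [lra|apply Rmin_l].
Qed.

Lemma convergent_bound n F : convergent n F ->
  exists r M, 0 < r /\ 0 <= M /\ forall i Q, (i < n)%nat -> length Q = n ->
    Cnorm (F i Q) * r ^ sumQ Q <= M.
Proof.
  intros H; destruct (convergent_family n 1 (fun _ => F)) as (r & M & Hr & HM & HF); auto.
  exists r, M; repeat split; auto. intros; apply (HF 0%nat); auto.
Qed.

Lemma convergent_fadd n F G : convergent n F -> convergent n G -> convergent n (fadd F G).
Proof.
  intros HF HG.
  destruct (convergent_family n 2 (fun k => if Nat.eqb k 0 then F else G)) as (r & M & Hr & HM & H).
  { intros [|k] _; auto. }
  exists r, (M + M); split; auto. intros i Hi Q HQ.
  specialize (H 0%nat i Q) as H1; specialize (H 1%nat i Q) as H2; simpl in H1, H2.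
  assert (0 <= r ^ sumQ Q) by (apply pow_le; lra).
  apply Rle_trans with ((Cnorm (F i Q) + Cnorm (G i Q)) * r ^ sumQ Q).
  - apply Rmult_le_compat_r; auto. apply Cnorm_triangle.
  - rewrite Rmult_plus_distr_r; apply Rplus_le_compat; auto.
Qed.

Lemma convergent_fscal n c F : convergent n F -> convergent n (fscal c F).
Proof.
  intros H; destruct (convergent_bound n F H) as (r & M & Hr & HM & HF).
  exists r, (Cnorm c * M); split; auto. intros i Hi Q HQ; unfold fscal, sscal.
  rewrite Cnorm_mul, Rmult_assoc; apply Rmult_le_compat_l; auto.
Qed.

Lemma convergent_linear n F : is_linear n F -> convergent n F.
Proof.
  intros H; exists 1, (rsum (seq 0 n) (fun i => rsum (seq 0 n) (fun j => Cnorm (F i (unitv n j)))));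
    split; [lra|].
  intros i Hi Q HQ; rewrite pow1, Rmult_1_r.
  assert (forall i, 0 <= rsum (seq 0 n) (fun j => Cnorm (F i (unitv n j)))) as Hp.
  { intros; apply rsum_ge0; auto. }
  destruct (Nat.eq_dec (sumQ Q) 1) as [E|E].
  - destruct (sumQ_1 n Q HQ E) as (j & Hj & ->).
    eapply Rle_trans; [|apply (rsum_term (seq 0 n) (fun i => rsum (seq 0 n) (fun j => Cnorm (F i (unitv n j))))
      i); [auto|apply in_seq; lia]].
    apply (rsum_term (seq 0 n) (fun j => Cnorm (F i (unitv n j)))); auto. apply in_seq; lia.
  - rewrite H, Cnorm_0 by auto. apply rsum_ge0; auto.
Qed.

Lemma convergent_fcomp n F G : fixes0 n G -> convergent n F -> convergent n G ->
  convergent n (fcomp n F G).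
Proof.
  intros H0 HF HG.
  destruct (convergent_bound n F HF) as (r & M & Hr & HM & HFb).
  destruct (convergent_bound n G HG) as (r' & M' & Hr' & HM' & HGb).
  set (A := 2 ^ n). assert (1 <= A) as HA by (apply pow_R1_Rle; lra).
  (* At radius t = y r' the components of G have norm at most M' (2y) A by order 1; this [y] keeps
     it below r / 2, where F is summed geometrically. *)
  set (y := Rmin (1 / 2) (r / (4 * (M' + 1) * A))).
  assert (0 < 4 * (M' + 1) * A) as Hq by (apply Rmult_lt_0_compat; lra).
  assert (0 < y) as Hy by (apply Rmin_glb_lt; [lra|]; apply Rdiv_lt_0_compat; auto).
  assert (y <= 1 / 2) as Hy1 by apply Rmin_l.
  assert (M' * (2 * y) * A <= r / 2) as Hyr.
  { assert (y * (4 * (M' + 1) * A) <= r); [|nra].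
    apply Rle_trans with (r / (4 * (M' + 1) * A) * (4 * (M' + 1) * A)); [|right; field; lra].
    apply Rmult_le_compat_r; [lra|apply Rmin_r]. }
  set (t := y * r').
  assert (0 < t) as Ht by (apply Rmult_lt_0_compat; auto).
  exists t, (M * A); split; auto. intros i Hi Q HQ.
  set (W := fun Q => t ^ sumQ Q).
  assert (forall Q, 0 <= W Q) as HW by (intros; apply pow_le; lra).
  set (B := sumQ Q).
  apply Rle_trans with (wnorm n B W (fcomp n F G i)).
  { apply (rsum_term (multi_le n B) (fun Q => Cnorm (fcomp n F G i Q) * W Q)).
    - intros; apply Rmult_le_pos; auto.
    - apply in_multi_le; auto. }
  unfold fcomp; eapply Rle_trans; [apply (wnorm_scomp n B W (F i) G (r / 2)); auto|].
  - intros P HP _; apply wnorm_smon; auto.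
    + unfold W; rewrite zeroQ_sum; reflexivity.
    + intros; unfold W; rewrite addQ_sum, pow_add by lia; lra.
    + intros j Hj; eapply Rle_trans; [|apply Hyr].
      replace (2 * y) with ((2 * y) ^ 1) by ring.
      apply rsum_order; auto; try lra.
      intros P' HP' Hs. rewrite (sumQ_0 P') by lia. rewrite HP'; auto.
  - replace (M * A) with (M * (2 * (1 / 2)) ^ 0 * A) by (simpl; ring).
    replace (r / 2) with (1 / 2 * r) by field.
    apply rsum_order; auto; try lra. intros; lia.
Qed.

(** * Inverses of maps tangent to the identity *)

Definition hot (F : fmap) : fmap := fun i Q => if le_dec (sumQ Q) 1 then C0 else F i Q.

Lemma hot_decomp n F c : fixes0 n F -> feq n (linop n F) (diagmap n c) ->
  feq n F (fadd (diagmap n c) (hot F)).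
Proof.
  intros H0 H i Hi Q HQ; unfold fadd, sadd, hot.
  destruct le_dec as [Hl|Hl].
  - destruct (Nat.eq_dec (sumQ Q) 1) as [E|E].
    + destruct (sumQ_1 n Q HQ E) as (j & Hj & ->); rewrite <- H by auto.
      unfold linop; rewrite linmap_unitv by auto; unfold linpart; ring.
    + rewrite (sumQ_0 Q) by lia; rewrite HQ, H0, diagmap_fixes0 by auto; ring.
  - rewrite diagmap_linear by (auto; lia); ring.
Qed.

Lemma scomp_hot_decomp n F c phi i Q : fixes0 n F -> fixes0 n phi ->
  feq n (linop n F) (diagmap n c) -> (i < n)%nat -> length Q = n ->
  fcomp n F phi i Q = Cadd (Cmul (c i) (phi i Q)) (scomp n (hot F i) phi Q).
Proof.
  intros H0 Hphi H Hi HQ.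
  transitivity (fcomp n (fadd (diagmap n c) (hot F)) phi i Q).
  - apply fcomp_proper; auto; [now apply hot_decomp|reflexivity].
  - unfold fcomp, fadd; rewrite scomp_sadd; f_equal. apply (fcomp_diag_l n c phi); auto.
Qed.

Lemma hot_bound F r M n : 0 <= M ->
  (forall i Q, (i < n)%nat -> length Q = n -> Cnorm (F i Q) * r ^ sumQ Q <= M) ->
  forall i Q, (i < n)%nat -> length Q = n -> Cnorm (hot F i Q) * r ^ sumQ Q <= M.
Proof.
  intros HM H i Q Hi HQ; unfold hot; destruct le_dec; auto. rewrite Cnorm_0; lra.
Qed.

Lemma hot_order F i Q : (sumQ Q < 2)%nat -> hot F i Q = C0.
Proof. intros; unfold hot; destruct le_dec; auto; lia. Qed.

Definition agree (n m : nat) (F G : fmap) : Prop :=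
  forall i Q, (i < n)%nat -> length Q = n -> (sumQ Q <= m)%nat -> F i Q = G i Q.

(** In degree q of phi^P each factor enters with degree at most q - (|P| - 1), since every other
    factor uses up at least one. For |P| >= 2 a degree of agreement is gained, which makes the
    iteration below stabilize. *)
Lemma smon_agree n m F G P : fixes0 n F -> fixes0 n G -> agree n m F G -> length P = n ->
  forall Q, length Q = n -> (S (sumQ Q) <= m + sumQ P)%nat -> smon F P 0 Q = smon G P 0 Q.
Proof.
  intros HF HG H; revert P. refine (midx_ind n _ _ _).
  - intros Q HQ _; rewrite !(smon_0 n) by auto; reflexivity.
  - intros i P Hi HP IH Q HQ Hs; rewrite !(smon_step n), !(smulE n (sumQ Q)) by auto.
    rewrite addQ_sum, unitv_sum in Hs by (rewrite ?unitv_length; auto).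
    apply lsum_ext; intros U HU; apply lsum_ext; intros V HV; apply in_multi_le in HU, HV.
    destruct (Qdec _ Q) as [E|]; auto.
    assert (sumQ Q = sumQ U + sumQ V)%nat as Hs' by (rewrite <- E; apply addQ_sum; lia).
    destruct (Qdec U (zeroQ n)) as [->|HU0]; [rewrite HF, HG by auto; ring|].
    apply sumQ_pos in HU0; [|tauto].
    destruct (le_lt_dec (sumQ P) (sumQ V)).
    + rewrite H, IH by (tauto || lia); reflexivity.
    + rewrite !(smon_order n) by tauto; ring.
Qed.

Lemma scomp_hot_agree n m U F G i : fixes0 n F -> fixes0 n G -> agree n m F G ->
  forall Q, length Q = n -> (sumQ Q <= S m)%nat -> scomp n (hot U i) F Q = scomp n (hot U i) G Q.
Proof.
  intros HF HG H Q HQ Hs; apply lsum_ext; intros P HP; apply in_multi_le in HP.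
  unfold hot; destruct le_dec; [ring|]. rewrite (smon_agree n m F G) by (tauto || lia); reflexivity.
Qed.

(** Picard iteration for G = id - hot F o G, that is F o G = id when F is tangent to the identity.
    The m-th iterate is final up to degree m, so the solution reads degree q off the q-th
    iterate. *)
Fixpoint inverse_approx (n : nat) (F : fmap) (m : nat) : fmap :=
  match m with
  | O => fid n
  | S m => fun i Q => Csub (fid n i Q) (scomp n (hot F i) (inverse_approx n F m) Q)
  end.

Lemma scomp_hot_low n F phi i Q : length Q = n -> (sumQ Q <= 1)%nat -> scomp n (hot F i) phi Q = C0.
Proof.
  intros HQ Hs; apply lsum_zero; intros P HP; apply in_multi_le in HP.
  rewrite hot_order by lia; ring.
Qed.

Lemma linop_low n F : fixes0 n F ->
  (forall i Q, (i < n)%nat -> length Q = n -> (sumQ Q <= 1)%nat -> F i Q = fid n i Q) ->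
  feq n (linop n F) (fid n).
Proof.
  intros H0 H; rewrite <- (linop_fid n); apply linmap_ext; intros i j Hi Hj; unfold linpart.
  apply H; auto using unitv_length. rewrite unitv_sum; auto.
Qed.

Lemma formal_right_inverse n F : fixes0 n F -> feq n (linop n F) (fid n) ->
  exists G, fixes0 n G /\ feq n (linop n G) (fid n) /\ feq n (fcomp n F G) (fid n).
Proof.
  intros H0 H1.
  assert (forall m, fixes0 n (inverse_approx n F m)) as Hfix.
  { intros [|m] i Hi; simpl; [apply fid_fixes0; auto|].
    rewrite scomp_hot_low, fid_fixes0 by (rewrite ?zeroQ_sum, ?repeat_length; auto). ring. }
  assert (forall m, agree n m (inverse_approx n F m) (inverse_approx n F (S m))) as Hag.
  { induction m; intros i Q Hi HQ Hs.
    - simpl; rewrite scomp_hot_low by (auto; lia); ring.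
    - change (Csub (fid n i Q) (scomp n (hot F i) (inverse_approx n F m) Q) =
        Csub (fid n i Q) (scomp n (hot F i) (inverse_approx n F (S m)) Q)).
      f_equal; apply (scomp_hot_agree n m); auto. }
  assert (forall d m, agree n m (inverse_approx n F m) (inverse_approx n F (d + m))) as Hag'.
  { induction d; intros m i Q Hi HQ Hs; [reflexivity|].
    rewrite IHd by auto; apply Hag; auto; lia. }
  set (G := fun i Q => inverse_approx n F (sumQ Q) i Q).
  assert (forall m, agree n m G (inverse_approx n F m)) as HG.
  { intros m i Q Hi HQ Hs; unfold G. rewrite (Hag' (m - sumQ Q)%nat) by auto.
    now replace (m - sumQ Q + sumQ Q)%nat with m by lia. }
  assert (forall i Q, (i < n)%nat -> length Q = n ->
    G i Q = Csub (fid n i Q) (scomp n (hot F i) G Q)) as HGe.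
  { intros i Q Hi HQ. rewrite (HG (S (sumQ Q))) by auto; simpl; f_equal.
    apply (scomp_hot_agree n (sumQ Q)); auto.
    - intros j Hj; rewrite (HG 0%nat); rewrite ?zeroQ_sum; auto using repeat_length; apply Hfix, Hj.
    - intros j P Hj HP Hs; symmetry; apply HG; auto. }
  assert (fixes0 n G) as HG0.
  { intros j Hj; rewrite (HG 0%nat); rewrite ?zeroQ_sum; auto using repeat_length; apply Hfix, Hj. }
  exists G; split; auto. split.
  - apply linop_low; auto. intros i Q Hi HQ Hs; rewrite HGe, scomp_hot_low by auto; ring.
  - intros i Hi Q HQ. rewrite (scomp_hot_decomp n F (fun _ => C1)) by (auto; rewrite <- fid_diag; auto).
    rewrite HGe at 1 by auto; ring.
Qed.

(** The right inverse G is again tangent to the identity and has a right inverse K; then K = F o G o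
    K = F, so G is also a left inverse. *)
Lemma formal_inverse n F : fixes0 n F -> feq n (linop n F) (fid n) ->
  exists G, fixes0 n G /\ feq n (linop n G) (fid n) /\
    feq n (fcomp n F G) (fid n) /\ feq n (fcomp n G F) (fid n).
Proof.
  intros H0 H1.
  destruct (formal_right_inverse n F) as (G & HG0 & HG1 & HFG); auto.
  destruct (formal_right_inverse n G) as (K & HK0 & HK1 & HGK); auto.
  exists G; repeat split; auto.
  assert (feq n K F) as E; [|now rewrite <- E].
  rewrite <- (fcomp_fid_l n K), <- HFG, fcomp_assoc, HGK, fcomp_fid_r by auto. reflexivity.
Qed.

Lemma linop_fid_unitv n F i j : feq n (linop n F) (fid n) -> (i < n)%nat -> (j < n)%nat ->
  Cnorm (F i (unitv n j)) <= 1.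
Proof.
  intros H Hi Hj. replace (F i (unitv n j)) with (fid n i (unitv n j)).
  - rewrite fidE by auto; destruct Nat.eq_dec; rewrite ?Cnorm_1, ?Cnorm_0; lra.
  - rewrite <- H by auto using unitv_length. unfold linop; now rewrite linmap_unitv.
Qed.

(** The equation G = id - hot F o G has no small divisors, so [majorant] applies with one map and
    trivial weights E = D = 1. *)
Lemma convergent_inverse n F G : convergent n F -> fixes0 n F -> fixes0 n G ->
  feq n (linop n F) (fid n) -> feq n (linop n G) (fid n) -> feq n (fcomp n F G) (fid n) ->
  convergent n G.
Proof.
  intros HF HF0 HG0 HF1 HG1 HFG.
  destruct (convergent_bound n F HF) as (r & M & Hr & HM & HFb).
  destruct (majorant n 1 r M) as (t & s & Ht & H); auto.
  exists t, s; split; auto. intros i Hi Q HQ.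
  replace (t ^ sumQ Q) with (t ^ sumQ Q * 1) by ring.
  apply (H (sumQ Q) (fun _ => 1) (fun _ => 1) (fun _ => hot F)); auto; try (intros; lra).
  - intros; apply linop_fid_unitv; auto.
  - intros; apply hot_bound with (n := n); auto.
  - intros; apply hot_order; auto.
  - intros j P Hj HP Hs. rewrite Rmult_1_l; unfold lsum; simpl; rewrite Rplus_0_r.
    rewrite fid_diag in HF1. specialize (HFG j Hj P HP).
    rewrite (scomp_hot_decomp n F (fun _ => C1)), fid_linear in HFG by (auto; lia).
    replace (G j P) with (Copp (scomp n (hot F j) G P)); [rewrite Cnorm_opp; lra|].
    transitivity (Cadd (Copp (scomp n (hot F j) G P)) C0); [ring|]. rewrite <- HFG; ring.
Qed.

Lemma local_inverse n F : convergent n F -> fixes0 n F -> feq n (linop n F) (fid n) ->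
  exists G, convergent n G /\ finverse n F G.
Proof.
  intros HF H0 H1; destruct (formal_inverse n F) as (G & HG0 & HG1 & HFG & HGF); auto.
  exists G; split; [apply (convergent_inverse n F)|repeat split]; auto.
Qed.

(** * Small divisors *)

Lemma fold_Rmin_le x l y : In y (x :: l) -> fold_right Rmin x l <= y.
Proof.
  induction l as [|z l IH]; simpl; intros H.
  - destruct H as [->|[]]; lra.
  - destruct H as [->|[->|H]].
    + eapply Rle_trans; [apply Rmin_r|apply IH; simpl; auto].
    + apply Rmin_l.
    + eapply Rle_trans; [apply Rmin_r|apply IH; simpl; auto].
Qed.

Lemma fold_Rmin_in x l : In (fold_right Rmin x l) (x :: l).
Proof.
  induction l as [|z l IH]; simpl; auto.
  simpl in IH; unfold Rmin at 1 3 5; destruct Rle_dec; tauto.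
Qed.

Lemma fold_Rmax_ge x l y : In y (x :: l) -> y <= fold_right Rmax x l.
Proof.
  induction l as [|z l IH]; simpl; intros H.
  - destruct H as [->|[]]; lra.
  - destruct H as [->|[->|H]].
    + eapply Rle_trans; [apply IH; simpl; auto|apply Rmax_r].
    + apply Rmax_l.
    + eapply Rle_trans; [apply IH; simpl; auto|apply Rmax_r].
Qed.

Lemma fold_Rmax_in x l : In (fold_right Rmax x l) (x :: l).
Proof.
  induction l as [|z l IH]; simpl; auto.
  simpl in IH; unfold Rmax at 1 3 5; destruct Rle_dec; tauto.
Qed.

Lemma minl_le l x : In x l -> minl l <= x.
Proof. destruct l; [intros []|apply fold_Rmin_le]. Qed.

Lemma minl_in l : l <> [] -> In (minl l) l.
Proof. destruct l; [congruence|intros _; apply fold_Rmin_in]. Qed.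

Lemma maxl_ge l x : In x l -> x <= maxl l.
Proof. destruct l; [intros []|apply fold_Rmax_ge]. Qed.

Lemma maxl_in l : l <> [] -> In (maxl l) l.
Proof. destruct l; [congruence|intros _; apply fold_Rmax_in]. Qed.

Definition divisor (lam : nat -> nat -> cplx) (Q : list nat) (k j : nat) : R :=
  Cnorm (Csub (Cmon (lam k) Q 0) (lam k j)).

(** The reason for the maximum over k: in every component j, one of the h conjugacy equations has a
    divisor at least eps_Q and can be solved with it. *)
Lemma epsQ_le_divisor n h lam Q j : (1 <= h)%nat -> (j < n)%nat ->
  exists k, (k < h)%nat /\ epsQ n h lam Q <= divisor lam Q k j.
Proof.
  intros Hh Hj.
  assert (In (maxl (map (fun k => divisor lam Q k j) (seq 0 h))) (map (fun k => divisor lam Q k j) (seq 0 h))) as H.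
  { apply maxl_in; destruct h; [lia|discriminate]. }
  apply in_map_iff in H; destruct H as (k & E & Hk); apply in_seq in Hk.
  exists k; split; [lia|]. rewrite E; apply minl_le.
  apply (in_map (fun j => maxl (map (fun k => divisor lam Q k j) (seq 0 h)))), in_seq; lia.
Qed.

(** A small eps_Q brings Lambda_k^Q close to lambda_(k,j) with one j common to all k, which is what
    the gap estimate relies on. *)
Lemma divisor_le_epsQ n h lam Q : (1 <= n)%nat ->
  exists j, (j < n)%nat /\ forall k, (k < h)%nat -> divisor lam Q k j <= epsQ n h lam Q.
Proof.
  intros Hn.
  assert (In (epsQ n h lam Q) (map (fun j => maxl (map (fun k => divisor lam Q k j) (seq 0 h))) (seq 0 n))) as H.
  { apply minl_in; destruct n; [lia|discriminate]. }
  apply in_map_iff in H; destruct H as (j & E & Hj); apply in_seq in Hj.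
  exists j; split; [lia|]. intros k Hk; rewrite <- E; apply maxl_ge.
  apply (in_map (fun k => divisor lam Q k j)), in_seq; lia.
Qed.

Lemma in_omega_cands n h lam m Q : In Q (omega_cands n h lam m) <->
  length Q = n /\ (2 <= sumQ Q <= m)%nat /\ totally_resonant n h lam Q = false.
Proof.
  unfold omega_cands; rewrite filter_In, in_multi_le, Bool.andb_true_iff, Nat.leb_le, Bool.negb_true_iff.
  tauto.
Qed.

Lemma omega_le n h lam m w Q : omega n h lam m = Some w ->
  In Q (omega_cands n h lam m) -> w <= epsQ n h lam Q.
Proof.
  unfold omega; intros H HQ; apply (in_map (epsQ n h lam)) in HQ.
  destruct (map _ _) as [|x l]; [discriminate|]. injection H; intros <-. apply fold_Rmin_le, HQ.
Qed.

Lemma omega_attained n h lam m w : omega n h lam m = Some w ->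
  exists Q, In Q (omega_cands n h lam m) /\ w = epsQ n h lam Q.
Proof.
  unfold omega; intros H; destruct (map _ _) as [|x l] eqn:E; [discriminate|]. injection H; intros <-.
  pose proof (fold_Rmin_in x l) as Hi; rewrite <- E in Hi; apply in_map_iff in Hi.
  destruct Hi as (Q & E' & HQ); exists Q; auto.
Qed.

Lemma omega_some n h lam m Q : In Q (omega_cands n h lam m) -> exists w, omega n h lam m = Some w.
Proof.
  unfold omega; intros H; apply (in_map (epsQ n h lam)) in H.
  destruct (map _ _) as [|x l]; [destruct H|eauto].
Qed.

(** Brjuno's counting lemma for a single scale [m], in the form of an explicit superadditive function:
    [G Q] is the minimum of [b |Q|] and of [b |Q'| - m] over small [Q'] strictly above [Q], where
    [b q = 2q - m] for [q > m] and [0] otherwise; it bounds [m] times the number of small divisors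
    that can occur in a tree of total weight [Q]. *)
Lemma scale_weight n m (small : list nat -> Prop) :
  (forall Q, length Q = n -> small Q -> (m < sumQ Q)%nat) ->
  (forall Q R, length Q = n -> length R = n -> R <> zeroQ n ->
     small Q -> small (addQ Q R) -> (m <= sumQ R)%nat) ->
  exists G : list nat -> nat, (forall Q, length Q = n -> (G Q <= 2 * sumQ Q)%nat) /\
    forall P R, length P = n -> length R = n -> P <> zeroQ n -> R <> zeroQ n ->
      (G P + G R <= G (addQ P R))%nat /\
      (small (addQ P R) -> (m + G P + G R <= G (addQ P R))%nat).
Proof.
  intros Hm Hgap.
  set (b := fun q => if le_dec q m then 0%nat else (2 * q - m)%nat).
  set (X := fun Q x => x = b (sumQ Q) \/ exists R, length R = n /\ R <> zeroQ n /\ small (addQ Q R) /\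
    x = (b (sumQ (addQ Q R)) - m)%nat).
  assert (forall Q, {x | X Q x /\ forall y, X Q y -> (x <= y)%nat}) as HX.
  { intros Q; apply constructive_indefinite_description.
    destruct (dec_inh_nat_subset_has_unique_least_element (X Q)) as (x & H & _).
    - intros x; apply classic.
    - exists (b (sumQ Q)); left; auto.
    - exists x; auto. }
  set (G := fun Q => proj1_sig (HX Q)).
  assert (forall Q, X Q (G Q)) as HG by (intros Q; apply (proj2_sig (HX Q))).
  assert (forall Q x, X Q x -> (G Q <= x)%nat) as HGle by (intros Q; apply (proj2_sig (HX Q))).
  assert (forall Q, (G Q <= b (sumQ Q))%nat) as HGb by (intros Q; apply HGle; left; auto).
  exists G; split.
  { intros Q HQ; specialize (HGb Q); unfold b in HGb; destruct le_dec; lia. }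
  (* The bound against the candidate b |P + R|. If P + R is small, it is itself a small index above
     both P and R, so each of G P and G R is at most b |P + R| - m. *)
  assert (forall P R, length P = n -> length R = n -> P <> zeroQ n -> R <> zeroQ n ->
    (G P + G R <= b (sumQ (addQ P R)))%nat /\
    (small (addQ P R) -> (m + G P + G R <= b (sumQ (addQ P R)))%nat)) as H1.
  { intros P R HP HR HP0 HR0.
    pose proof (HGb P) as HGP; pose proof (HGb R) as HGR; rewrite addQ_sum by lia.
    split.
    - unfold b in *; repeat destruct le_dec; lia.
    - intros Hs; pose proof (Hm _ (addQ_length _ _ _ HP HR) Hs) as Hl; rewrite addQ_sum in Hl by lia.
      assert (G P <= b (sumQ P + sumQ R) - m)%nat as HP'.
      { apply HGle; right; exists R; rewrite addQ_sum by lia; auto. }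
      assert (G R <= b (sumQ P + sumQ R) - m)%nat as HR'.
      { apply HGle; right; exists P; rewrite (addQ_comm R P), addQ_sum by lia; auto. }
      unfold b in *; repeat destruct le_dec; lia. }
  intros P R HP HR HP0 HR0; destruct (H1 P R) as [Ha Hb]; auto.
  (* Otherwise the minimum for P + R comes from a small P + R + T, which also lies above P (by R +
     T) and above R (by P + T). *)
  destruct (HG (addQ P R)) as [->|(T & HT & HT0 & HTs & ->)]; auto.
  pose proof (addQ_length _ _ _ HP HR) as HPR.
  pose proof (Hm _ (addQ_length _ _ _ HPR HT) HTs) as Hl.
  assert (G P <= b (sumQ (addQ (addQ P R) T)) - m)%nat as HP'.
  { apply HGle; right; exists (addQ R T); rewrite <- addQ_assoc; repeat split; auto using addQ_length.
    intros E; apply (f_equal sumQ) in E; apply sumQ_pos in HT0; auto.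
    rewrite addQ_sum, zeroQ_sum in E; lia. }
  assert (G R <= b (sumQ (addQ (addQ P R) T)) - m)%nat as HR'.
  { apply HGle; right; exists (addQ P T); rewrite <- addQ_assoc, (addQ_comm R P).
    repeat split; auto using addQ_length.
    intros E; apply (f_equal sumQ) in E; apply sumQ_pos in HT0; auto.
    rewrite addQ_sum, zeroQ_sum in E; lia. }
  pose proof (HGb P) as HGP; pose proof (HGb R) as HGR.
  apply sumQ_pos in HT0; auto.
  rewrite !addQ_sum in * by lia. split.
  - unfold b in *; repeat destruct le_dec; lia.
  (* With P + R small too, the gap gives |T| >= m, so b |P + R + T| - m is at least b |P + R| and
     the bound [Hb] suffices. *)
  - intros Hs; specialize (Hb Hs). specialize (Hgap _ _ HPR HT).
    assert (m <= sumQ T)%nat by (apply Hgap; auto; intros ->; rewrite zeroQ_sum in HT0; lia).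
    unfold b in *; repeat destruct le_dec; lia.
Qed.

Lemma ln_inv_le x y : 0 < x -> x <= y -> ln (/ y) <= ln (/ x).
Proof.
  intros Hx Hy; rewrite !ln_Rinv by lra. apply Ropp_le_contravar.
  destruct (Req_dec x y) as [->|]; [lra|]. left; apply ln_increasing; lra.
Qed.

Lemma ln_inv_ge0 x : 0 < x -> x <= 1 -> 0 <= ln (/ x).
Proof. intros; rewrite <- ln_1, <- Rinv_1; apply ln_inv_le; lra. Qed.

(** The weights of all scales [p (S nu)] are added up; a divisor smaller than [theta w_nu] but not
    smaller than [theta w_(nu+1)] is charged to the scale [nu]. *)
Lemma brjuno_weights n (eps : list nat -> R) (p : nat -> nat) (w : nat -> R) theta M :
  (forall nu, (p nu < p (S nu))%nat) ->
  (forall nu, 0 < w nu) -> (forall nu, w (S nu) <= w nu) ->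
  (forall nu Q, length Q = n -> (2 <= sumQ Q <= p (S nu))%nat -> w nu <= eps Q) ->
  0 < theta <= 1 ->
  (forall nu Q R, length Q = n -> length R = n -> R <> zeroQ n -> w nu <= 1 ->
     eps Q < theta * w nu -> eps (addQ Q R) < theta * w nu -> (p (S nu) <= sumQ R)%nat) ->
  (forall N, rsum (seq 0 N) (fun nu => / INR (p nu) * ln (/ w nu)) <= M) ->
  exists c, 0 <= c /\ forall B, exists K : list nat -> R,
    K (zeroQ n) = 0 /\ (forall Q, length Q = n -> 0 <= K Q <= c * INR (sumQ Q)) /\
    forall P R, length P = n -> length R = n -> P <> zeroQ n -> R <> zeroQ n ->
      (sumQ (addQ P R) <= B)%nat ->
      K P + K R <= K (addQ P R) /\ K P + K R + ln (/ eps (addQ P R)) <= K (addQ P R).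
Proof.
  intros Hp Hw0 Hw Hweps Hth Hgap HM.
  assert (forall nu, (nu <= p nu)%nat) as Hpn.
  { induction nu; [lia|]; specialize (Hp nu); lia. }
  assert (forall d nu, w (d + nu)%nat <= w nu) as Hwd.
  { induction d; intros nu; simpl; [lra|]. eapply Rle_trans; [apply Hw|apply IHd]. }
  assert (forall a q, INR (q - 1) <= INR (a + q)) as Hsub by (intros; apply le_INR; lia).
  (* If the divisors are bounded below, one constant per product suffices. If not, some divisor lies
     below theta, so w_nu <= theta from some scale nu0 on; this makes the logarithms nonnegative and
     meets the condition w_nu <= 1 of the gap. *)
  destruct (classic (exists c, 0 < c /\ forall Q, length Q = n -> (2 <= sumQ Q)%nat -> c <= eps Q))
    as [(c & Hc & Heps)|Hno].
  - set (kappa := ln (/ Rmin c 1)).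
    assert (0 < Rmin c 1) as Hm by (apply Rmin_glb_lt; lra).
    assert (0 <= kappa) as Hk by (apply ln_inv_ge0; auto; apply Rmin_r).
    (* For nonzero P and R, |Q| - 1 increases by exactly one when they are joined, which gains one
       kappa; truncated subtraction gives 0 at Q = 0. *)
    exists kappa; split; auto. intros B; exists (fun Q => kappa * INR (sumQ Q - 1)); split.
    { rewrite zeroQ_sum; simpl; ring. } split.
    { intros Q HQ; split; [apply Rmult_le_pos; auto using pos_INR|].
      apply Rmult_le_compat_l; auto. apply (Hsub 0%nat). }
    intros P R HP HR HP0 HR0 Hl.
    apply sumQ_pos in HP0, HR0; auto.
    assert (kappa * INR (sumQ (addQ P R) - 1) = kappa * INR (sumQ P - 1) + kappa * INR (sumQ R - 1) + kappa) as ->.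
    { rewrite addQ_sum by lia.
      replace (sumQ P + sumQ R - 1)%nat with (sumQ P - 1 + (sumQ R - 1) + 1)%nat by lia.
      rewrite !plus_INR; simpl; ring. }
    split; [lra|]. apply Rplus_le_compat_l, ln_inv_le; auto.
    eapply Rle_trans; [apply Rmin_l|apply Heps]; auto using addQ_length. rewrite addQ_sum; lia.
  - assert (exists nu0, forall nu, (nu0 <= nu)%nat -> w nu <= theta) as (nu0 & Hnu0).
    { apply not_ex_all_not with (n := theta) in Hno; apply not_and_or in Hno.
      destruct Hno as [H|H]; [lra|]. apply not_all_ex_not in H; destruct H as (Q & H).
      apply imply_to_and in H; destruct H as (HQ & H); apply imply_to_and in H; destruct H as (H2 & H).
      exists (sumQ Q); intros nu Hnu.
      apply Rle_trans with (eps Q); [|lra]. apply Hweps; auto. split; auto.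
      specialize (Hpn (S nu)); lia. }
    set (small := fun nu Q => (2 <= sumQ Q)%nat /\ eps Q < theta * w nu).
    assert (forall nu, {G : list nat -> nat | (nu0 <= nu)%nat ->
       (forall Q, length Q = n -> (G Q <= 2 * sumQ Q)%nat) /\
       forall P R, length P = n -> length R = n -> P <> zeroQ n -> R <> zeroQ n ->
        (G P + G R <= G (addQ P R))%nat /\
        (small nu (addQ P R) -> (p (S nu) + G P + G R <= G (addQ P R))%nat)}) as HG.
    { intros nu; apply constructive_indefinite_description.
      destruct (le_lt_dec nu0 nu) as [Hnu|Hnu]; [|exists (fun _ => 0%nat); lia].
      destruct (scale_weight n (p (S nu)) (small nu)) as (G & HG).
      - intros Q HQ [H2 Hs]. destruct (le_lt_dec (sumQ Q) (p (S nu))); auto.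
        assert (w nu <= eps Q) by (apply Hweps; auto). specialize (Hw0 nu). nra.
      - intros Q R HQ HR HR0 [_ H1] [_ H2]. apply (Hgap nu Q R); auto.
        eapply Rle_trans; [apply Hnu0; auto|lra].
      - exists G; auto. }
    set (G := fun nu => proj1_sig (HG nu)).
    set (l := fun nu => ln (/ (theta * w (S nu)))).
    assert (forall nu, 0 < theta * w nu) as Htw by (intros; apply Rmult_lt_0_compat; [lra|auto]).
    assert (forall nu, (nu0 <= nu)%nat -> 0 <= ln (/ (theta * w nu))) as Hlog.
    { intros nu Hnu; apply ln_inv_ge0; auto. specialize (Hnu0 nu Hnu); specialize (Hw0 nu); nra. }
    assert (forall nu, 0 < INR (p (S nu))) as Hppos by (intros; apply lt_0_INR; specialize (Hp nu); lia).
    assert (forall nu, 0 < / INR (p (S nu))) as Hpinv by (intros; apply Rinv_0_lt_compat; auto).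
    (* Pays in every product for the divisors that are not below theta w_nu0, so the scales before
       nu0 need no weight of their own. *)
    set (kappa := ln (/ (theta * w nu0))).
    assert (0 <= kappa) as Hk by (apply Hlog; auto).
    set (f := fun nu => / INR (p nu) * ln (/ w nu)).
    (* The early terms may be negative, as w may exceed 1, so the tail is bounded by M minus the
       initial segment. That segment ends at nu0 included because [l nu] involves w_(nu+1). *)
    set (c' := M - rsum (seq 0 (S nu0)) f).
    assert (forall B, rsum (seq nu0 (S B)) (fun nu => / INR (p (S nu)) * l nu) <= 2 * c') as Hsum.
    { intros B.
      apply Rle_trans with (2 * rsum (seq nu0 (S B)) (fun nu => f (S nu))).
      - rewrite rsum_scal; apply rsum_le; intros nu Hnu; apply in_seq in Hnu; unfold f, l.
        (* Beyond nu0 the factor theta at most doubles the logarithm, since w <= theta there. The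
           other factor 2 in 4c' comes from G Q <= 2|Q|. *)
        assert (ln (/ (theta * w (S nu))) <= 2 * ln (/ w (S nu))); [|specialize (Hpinv nu); nra].
        assert (ln (/ theta) <= ln (/ w (S nu))) by (apply ln_inv_le; auto; apply Hnu0; lia).
        rewrite Rinv_mult, ln_mult by (apply Rinv_0_lt_compat; auto; lra). lra.
      - apply Rmult_le_compat_l; [lra|]. unfold c'.
        specialize (HM (S nu0 + S B)%nat); rewrite seq_app, lsum_app in HM; fold f in HM.
        assert (rsum (seq nu0 (S B)) (fun nu => f (S nu)) = rsum (seq (S nu0) (S B)) f) as ->; [|simpl plus in HM; lra].
        rewrite <- (seq_shift (S B) nu0); unfold lsum; rewrite map_map; reflexivity. }
    assert (0 <= c') as Hc'.
    { specialize (Hsum 0%nat). assert (0 <= rsum (seq nu0 1) (fun nu => / INR (p (S nu)) * l nu)); [|lra].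
      apply rsum_ge0; intros nu Hnu; apply in_seq in Hnu.
      apply Rmult_le_pos; [left; auto|apply Hlog; lia]. }
    exists (kappa + 4 * c'); split; [lra|]. intros B.
    (* A small divisor at scale nu raises [G nu] by p (S nu), so this normalization makes it raise
       [S1] by exactly [l nu]. *)
    set (S1 := fun Q => rsum (seq nu0 (S B)) (fun nu => / INR (p (S nu)) * l nu * INR (G nu Q))).
    exists (fun Q => kappa * INR (sumQ Q - 1) + S1 Q).
    assert (forall nu, In nu (seq nu0 (S B)) -> 0 <= / INR (p (S nu)) * l nu) as Hpl.
    { intros nu Hnu; apply in_seq in Hnu; apply Rmult_le_pos; [left; auto|apply Hlog; lia]. }
    assert (forall Q, length Q = n -> 0 <= S1 Q <= 4 * c' * INR (sumQ Q)) as HS1.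
    { intros Q HQ; split.
      - apply rsum_ge0; intros; apply Rmult_le_pos; auto using pos_INR.
      - apply Rle_trans with (rsum (seq nu0 (S B)) (fun nu => / INR (p (S nu)) * l nu) * (2 * INR (sumQ Q))).
        + rewrite rsum_scal_r; apply rsum_le; intros nu Hnu; apply Rmult_le_compat_l; auto.
          apply in_seq in Hnu; destruct (proj2_sig (HG nu)) as [H _]; [lia|]. fold (G nu) in H.
          specialize (H Q HQ); apply le_INR in H; rewrite mult_INR in H; simpl in H; lra.
        + specialize (Hsum B); pose proof (pos_INR (sumQ Q)); nra. }
    split; [|split].
    { rewrite zeroQ_sum; simpl sumQ; specialize (HS1 (zeroQ n) (repeat_length _ _)); rewrite zeroQ_sum in HS1.
      simpl in *; lra. }
    { intros Q HQ; specialize (HS1 Q HQ); specialize (Hsub 0%nat (sumQ Q)); simpl in Hsub.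
      pose proof (pos_INR (sumQ Q - 1)). split; nra. }
    intros P R HP HR HP0 HR0 Hl.
    pose proof HP0 as HP1; pose proof HR0 as HR1; apply sumQ_pos in HP1, HR1; auto.
    set (Q := addQ P R) in *.
    assert (sumQ Q = sumQ P + sumQ R)%nat as HQs by (apply addQ_sum; lia).
    assert (length Q = n) as HQ by (apply addQ_length; auto).
    assert (kappa * INR (sumQ Q - 1) = kappa * INR (sumQ P - 1) + kappa * INR (sumQ R - 1) + kappa) as ->.
    { rewrite HQs.
      replace (sumQ P + sumQ R - 1)%nat with (sumQ P - 1 + (sumQ R - 1) + 1)%nat by lia.
      rewrite !plus_INR; simpl; ring. }
    set (charge := fun nu => if Rlt_dec (eps Q) (theta * w nu) then l nu else 0).
    assert (forall nu, (nu0 <= nu)%nat -> 0 <= charge nu) as Hch0.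
    { intros nu Hnu; unfold charge; destruct Rlt_dec; [apply Hlog; lia|lra]. }
    assert (S1 P + S1 R + rsum (seq nu0 (S B)) charge <= S1 Q) as Hcharge.
    { unfold S1; rewrite <- !lsum_add; apply rsum_le; intros nu Hnu.
      specialize (Hpl nu Hnu); apply in_seq in Hnu.
      destruct (proj2_sig (HG nu)) as [_ H]; [lia|]. fold (G nu) in H.
      destruct (H P R) as [Ha Hb]; auto; fold Q in Ha, Hb.
      unfold charge; destruct Rlt_dec as [Hs|Hs].
      - assert (small nu Q) as Hsm by (split; auto; lia).
        specialize (Hb Hsm); apply le_INR in Hb; rewrite !plus_INR in Hb.
        replace (l nu) with (/ INR (p (S nu)) * l nu * INR (p (S nu))) at 3
          by (field; apply Rgt_not_eq, Hppos). nra.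
      - apply le_INR in Ha; rewrite plus_INR in Ha. nra. }
    (* Walk down the scales from a: while eps_Q is below theta w_a, the charge at a pays ln (1 /
       (theta w_(a+1))), the allowance needed at the next scale. *)
    assert (forall d a, (nu0 <= a)%nat -> ~ eps Q < theta * w (a + d)%nat ->
      ln (/ eps Q) <= ln (/ (theta * w a)) + rsum (seq a d) charge) as Hlog_le.
    { induction d; intros a Ha Hs.
      - rewrite Nat.add_0_r in Hs; unfold lsum; simpl; rewrite Rplus_0_r; apply ln_inv_le; auto; lra.
      - simpl seq; rewrite rsum_cons.
        assert (0 <= rsum (seq (S a) d) charge).
        { apply rsum_ge0; intros nu Hnu; apply in_seq in Hnu; apply Hch0; lia. }
        unfold charge at 1; destruct Rlt_dec as [Hl'|Hl'].
        + assert (ln (/ eps Q) <= ln (/ (theta * w (S a))) + rsum (seq (S a) d) charge).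
          { apply IHd; [lia|]. now replace (S a + d)%nat with (a + S d)%nat by lia. }
          unfold l; specialize (Hlog a Ha); lra.
        + assert (ln (/ eps Q) <= ln (/ (theta * w a))) by (apply ln_inv_le; auto; lra). lra. }
    specialize (Hlog_le (S B) nu0 (Nat.le_refl _)). fold kappa in Hlog_le.
    assert (ln (/ eps Q) <= kappa + rsum (seq nu0 (S B)) charge).
    { apply Hlog_le. set (nu := (nu0 + S B)%nat).
      assert (w nu <= eps Q) by (apply Hweps; auto; specialize (Hpn (S nu)); unfold nu in *; lia).
      specialize (Hw0 nu); nra. }
    assert (0 <= rsum (seq nu0 (S B)) charge).
    { apply rsum_ge0; intros nu Hnu; apply in_seq in Hnu; apply Hch0; lia. }
    lra.
Qed.

Lemma list_pos_lower_bound {I} (l : list I) (f : I -> R) : (forall x, In x l -> 0 < f x) ->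
  exists a, 0 < a /\ forall x, In x l -> a <= f x.
Proof.
  induction l as [|x l IH]; intros H; [exists 1; split; [lra|intros _ []]|].
  destruct IH as (a & Ha & Hl); [intros; apply H; simpl; auto|].
  exists (Rmin a (f x)); split; [apply Rmin_glb_lt; auto; apply H; simpl; auto|].
  intros y [->|Hy]; [apply Rmin_r|]. eapply Rle_trans; [apply Rmin_l|auto].
Qed.

(** [|Lambda^R|] is bounded, since [Lambda^Q] and [Lambda^(Q + R)] are both close to eigenvalues. *)
Lemma epsQ_gap n h lam : (1 <= n)%nat -> (1 <= h)%nat ->
  (forall k j, (k < h)%nat -> (j < n)%nat -> lam k j <> C0) ->
  exists theta, 0 < theta <= 1 /\ forall w Q R, 0 < w <= 1 -> length Q = n -> length R = n ->
    epsQ n h lam Q < theta * w -> epsQ n h lam (addQ Q R) < theta * w ->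
    exists j, (j < n)%nat /\ epsQ n h lam (addQ R (unitv n j)) < w.
Proof.
  intros Hn Hh Hlam.
  destruct (list_pos_lower_bound (list_prod (seq 0 h) (seq 0 n)) (fun kj => Cnorm (lam (fst kj) (snd kj))))
    as (a & Ha & Hlow).
  { intros [k j] H; apply in_prod_iff in H; rewrite !in_seq in H; simpl.
    destruct (Cnorm_ge0 (lam k j)) as [|E]; auto.
    destruct (Hlam k j); try lia. apply Cnorm_eq0; auto. }
  set (b := rsum (list_prod (seq 0 h) (seq 0 n)) (fun kj => Cnorm (lam (fst kj) (snd kj)))).
  assert (0 <= b) as Hb by (apply rsum_ge0; auto).
  assert (forall k j, (k < h)%nat -> (j < n)%nat -> a <= Cnorm (lam k j) <= b) as Hab.
  { intros k j Hk Hj; assert (In (k, j) (list_prod (seq 0 h) (seq 0 n))) as H.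
    { apply in_prod_iff; rewrite !in_seq; lia. }
    split; [apply (Hlow (k, j) H)|].
    apply (rsum_term _ (fun kj => Cnorm (lam (fst kj) (snd kj))) (k, j)); auto. }
  set (A := 2 * (b + 1) / a).
  assert (0 < A) as HA by (apply Rdiv_lt_0_compat; lra).
  (* The bound a / 2 keeps |Lambda^Q| above a / 2, hence |Lambda^R| <= A; the bound 1 / (A + 2)
     makes (1 + A) theta w smaller than w. *)
  set (theta := Rmin (a / 2) (/ (A + 2))).
  assert (0 < / (A + 2)) as Hi by (apply Rinv_0_lt_compat; lra).
  assert (0 < theta) as Ht by (apply Rmin_glb_lt; lra).
  assert (theta <= a / 2) as Hta by apply Rmin_l.
  assert (theta * (A + 2) <= 1) as HtA.
  { apply Rle_trans with (/ (A + 2) * (A + 2)); [|right; field; lra].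
    apply Rmult_le_compat_r; [lra|apply Rmin_r]. }
  exists theta; split; [nra|].
  intros w Q R Hw HQ HR HsQ HsR.
  destruct (divisor_le_epsQ n h lam Q Hn) as (j & Hj & HQj).
  destruct (divisor_le_epsQ n h lam (addQ Q R) Hn) as (j' & Hj' & HRj).
  exists j; split; auto.
  (* Since j and j' serve all k at once, k can be chosen last, as one whose divisor at component j'
     dominates eps. *)
  destruct (epsQ_le_divisor n h lam (addQ R (unitv n j)) j' Hh Hj') as (k & Hk & Hle).
  specialize (HQj k Hk); specialize (HRj k Hk).
  apply (Rle_lt_trans _ _ _ Hle); unfold divisor in *.
  destruct (Hab k j Hk Hj) as [Hlo _]; destruct (Hab k j' Hk Hj') as [_ Hhi].
  rewrite Cmon_add in HRj by lia.
  rewrite Cmon_add, Cmon_unitv, Nat.add_0_r by (rewrite ?unitv_length; auto).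
  set (x := Cmon (lam k) Q 0) in *; set (z := Cmon (lam k) R 0) in *.
  set (d := Csub x (lam k j)) in *; set (d' := Csub (Cmul x z) (lam k j')) in *.
  assert (Cnorm (lam k j) <= Cnorm x + Cnorm d) as H1.
  { replace (lam k j) with (Csub x d) by (unfold d; ring). apply Cnorm_sub. }
  assert (Cnorm x * Cnorm z <= Cnorm (lam k j') + Cnorm d') as H2.
  { rewrite <- Cnorm_mul. replace (Cmul x z) with (Cadd (lam k j') d') by (unfold d'; ring).
    apply Cnorm_triangle. }
  assert (theta * w <= theta) as Htw by nra.
  assert (theta <= 1) as Ht1 by nra.
  assert (a / 2 * Cnorm z <= b + 1) as H3.
  { apply Rle_trans with (Cnorm x * Cnorm z); [|lra].
    apply Rmult_le_compat_r; auto; lra. }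
  assert (Cnorm z <= A) as Hz.
  { apply Rmult_le_reg_l with (a / 2); [lra|]. replace (a / 2 * A) with (b + 1); [auto|unfold A; field; lra]. }
  (* The divisor of R + e_j at j' is a combination of the two given small ones with the bounded
     coefficient Lambda^R. *)
  replace (Csub (Cmul z (lam k j)) (lam k j')) with (Csub d' (Cmul z d)) by (unfold d, d'; ring).
  apply Rle_lt_trans with (theta * w + A * (theta * w)).
  - eapply Rle_trans; [apply Cnorm_sub|]. rewrite Cnorm_mul.
    apply Rplus_le_compat; [lra|]. apply Rmult_le_compat; auto; lra.
  - nra.
Qed.

Lemma exp_pow x k : exp x ^ k = exp (x * INR k).
Proof.
  induction k; [simpl; rewrite Rmult_0_r, exp_0; auto|].
  rewrite S_INR; simpl; rewrite IHk, <- exp_plus; f_equal; ring.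
Qed.

Lemma epsQ_ge0 n h lam Q : (1 <= n)%nat -> (1 <= h)%nat -> 0 <= epsQ n h lam Q.
Proof.
  intros Hn Hh; destruct (divisor_le_epsQ n h lam Q Hn) as (j & _ & H).
  eapply Rle_trans; [|apply (H 0%nat); lia]. apply Cnorm_ge0.
Qed.

(** * The nonresonant case *)

Lemma simul_brjuno_weights n h lam : (1 <= n)%nat -> (1 <= h)%nat ->
  (forall k j, (k < h)%nat -> (j < n)%nat -> lam k j <> C0) ->
  (forall Q, length Q = n -> (2 <= sumQ Q)%nat -> totally_resonant n h lam Q = false) ->
  simul_brjuno n h lam ->
  (forall Q, length Q = n -> (2 <= sumQ Q)%nat -> 0 < epsQ n h lam Q) /\
  exists c, 0 <= c /\ forall B, exists K : list nat -> R,
    K (zeroQ n) = 0 /\ (forall Q, length Q = n -> 0 <= K Q <= c * INR (sumQ Q)) /\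
    forall P R, length P = n -> length R = n -> P <> zeroQ n -> R <> zeroQ n ->
      (sumQ (addQ P R) <= B)%nat ->
      K P + K R <= K (addQ P R) /\ K P + K R + ln (/ epsQ n h lam (addQ P R)) <= K (addQ P R).
Proof.
  intros Hn Hh Hlam Hres (p & Hp0 & Hp & Hom & M & HM).
  assert (forall nu, (S nu <= p nu)%nat) as Hpn.
  { induction nu; [lia|]; specialize (Hp nu); lia. }
  assert (forall nu, {w | omega n h lam (p (S nu)) = Some w}) as Hw.
  { intros nu; apply constructive_indefinite_description.
    (* The index 2 e_0 is always a candidate, so the minimum defining omega is never empty. *)
    apply (omega_some n h lam _ (addQ (unitv n 0) (unitv n 0))), in_omega_cands.
    assert (length (addQ (unitv n 0) (unitv n 0)) = n) as Hl by (apply addQ_length; apply unitv_length).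
    assert (sumQ (addQ (unitv n 0) (unitv n 0)) = 2%nat) as Hs.
    { rewrite addQ_sum, unitv_sum by lia; auto. }
    specialize (Hpn (S nu)). repeat split; auto; try lia. apply Hres; auto; lia. }
  set (w := fun nu => proj1_sig (Hw nu)).
  assert (forall nu, omega n h lam (p (S nu)) = Some (w nu)) as Hwe by (intros; apply (proj2_sig (Hw nu))).
  assert (forall nu Q, length Q = n -> (2 <= sumQ Q <= p (S nu))%nat -> w nu <= epsQ n h lam Q) as Hle.
  { intros nu Q HQ Hs; apply (omega_le n h lam _ _ _ (Hwe nu)), in_omega_cands. repeat split; auto; try lia.
    apply Hres; auto; lia. }
  assert (forall nu, 0 < w nu) as Hw0.
  { intros nu; destruct (omega_attained n h lam _ _ (Hwe nu)) as (Q & _ & E).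
    destruct (epsQ_ge0 n h lam Q Hn Hh) as [H|H]; [lra|].
    destruct (Hom nu); rewrite Hwe; f_equal; lra. }
  split.
  { intros Q HQ Hs; apply Rlt_le_trans with (w (sumQ Q)); auto. apply Hle; auto.
    split; auto. specialize (Hpn (S (sumQ Q))); lia. }
  destruct (epsQ_gap n h lam Hn Hh Hlam) as (theta & Ht & Hgap).
  apply (brjuno_weights n _ p w theta M); auto.
  - intros nu; destruct (omega_attained n h lam _ _ (Hwe nu)) as (Q & HQ & E).
    apply in_omega_cands in HQ. rewrite E; apply Hle; try tauto. specialize (Hp (S nu)); lia.
  - intros nu Q R HQ HR HR0 Hw1 H1 H2.
    destruct (Hgap (w nu) Q R) as (j & Hj & H); auto.
    apply sumQ_pos in HR0; auto.
    destruct (le_lt_dec (p (S nu)) (sumQ R)) as [|Hlt]; auto.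
    (* R + e_j has degree |R| + 1 >= 2; if |R| < p (S nu) it would be a candidate with divisor below
       the minimum. *)
    assert (w nu <= epsQ n h lam (addQ R (unitv n j))); [|lra].
    apply Hle; [apply addQ_length; auto using unitv_length|].
    rewrite addQ_sum, unitv_sum by (rewrite ?unitv_length; auto); lia.
  - intros N; eapply Rle_trans; [|apply (HM N)]. right; apply lsum_ext; intros nu _.
    unfold brjuno_term; rewrite Hwe; reflexivity.
Qed.

Lemma nonresonant_convergent n h lam g phi : (1 <= n)%nat -> (1 <= h)%nat ->
  (forall k j, (k < h)%nat -> (j < n)%nat -> lam k j <> C0) ->
  (forall Q, length Q = n -> (2 <= sumQ Q)%nat -> totally_resonant n h lam Q = false) ->
  simul_brjuno n h lam ->
  (forall k, (k < h)%nat -> convergent n (g k) /\ fixes0 n (g k) /\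
     feq n (linop n (g k)) (diagmap n (lam k)) /\
     feq n (fcomp n (g k) phi) (fcomp n phi (diagmap n (lam k)))) ->
  fixes0 n phi -> feq n (linop n phi) (fid n) ->
  convergent n phi.
Proof.
  intros Hn Hh Hlam Hres Hbr Hg H0 H1.
  destruct (simul_brjuno_weights n h lam) as (Heps & c & Hc & HK); auto.
  destruct (convergent_family n h g) as (r & M & Hr & HM & Hgb); [intros; apply Hg; auto|].
  destruct (majorant n h r M) as (t & s & Ht & Hmaj); auto.
  exists (t * exp (- c)), s; split; [apply Rmult_lt_0_compat; auto; apply exp_pos|].
  intros i Hi Q HQ.
  destruct (HK (sumQ Q)) as (K & HK0 & HKc & HKs).
  assert (Cnorm (phi i Q) * (t ^ sumQ Q * exp (- K Q)) <= s) as Hs.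
  { apply (Hmaj (sumQ Q) (fun Q => exp (- K Q)) (fun Q => / epsQ n h lam Q) (fun k => hot (g k))); auto.
    - intros; apply linop_fid_unitv; auto.
    - intros; left; apply exp_pos.
    (* eps vanishes at unit vectors, where [Rinv] returns 0; the estimates use D only in degree at
       least 2, where eps is positive. *)
    - intros P; destruct (epsQ_ge0 n h lam P Hn Hh) as [E|E]; [left; apply Rinv_0_lt_compat; auto|].
      rewrite <- E, Rinv_0; lra.
    - rewrite HK0, Ropp_0; apply exp_0.
    - intros j Hj; rewrite <- exp_0. specialize (HKc (unitv n j) (unitv_length n j)).
      destruct (Req_dec (K (unitv n j)) 0) as [->|]; [rewrite Ropp_0; lra|].
      left; apply exp_increasing; lra.
    - intros P R HP HR Hs HP0 HR0. destruct (HKs P R) as [Ha Hb]; auto.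
      assert (0 < epsQ n h lam (addQ P R)) as He.
      { apply Heps; [apply addQ_length; auto|]. apply sumQ_pos in HP0, HR0; auto.
        rewrite addQ_sum by lia; lia. }
      replace (/ epsQ n h lam (addQ P R)) with (exp (ln (/ epsQ n h lam (addQ P R))))
        by (apply exp_ln, Rinv_0_lt_compat; auto).
      rewrite <- !exp_plus.
      assert (forall x y, x <= y -> exp x <= exp y) as Hexp.
      { intros x y [H|H]; [left; apply exp_increasing; auto|rewrite H; lra]. }
      split; apply Hexp; lra.
    - intros k j P Hk; apply hot_bound with (n := n); auto.
    - intros; apply hot_order; auto.
    - intros j P Hj HP Hs.
      (* The germ k is chosen separately for every P and j, and the sum over all germs dominates its
         term. *)
      destruct (epsQ_le_divisor n h lam P j) as (k & Hk & Hd); auto.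
      destruct (Hg k Hk) as (_ & Hg0 & Hg1 & Hgphi). specialize (Hgphi j Hj P HP).
      rewrite (scomp_hot_decomp n (g k) (lam k)) in Hgphi by auto.
      unfold fcomp in Hgphi; rewrite scomp_diag in Hgphi by auto.
      assert (Cnorm (scomp n (hot (g k) j) phi P) = divisor lam P k j * Cnorm (phi j P)) as E.
      { unfold divisor; rewrite <- Cnorm_mul; f_equal.
        transitivity (Csub (Cadd (Cmul (lam k j) (phi j P)) (scomp n (hot (g k) j) phi P))
          (Cmul (lam k j) (phi j P))); [ring|]. rewrite Hgphi; ring. }
      specialize (Heps P HP (proj1 Hs)).
      apply Rmult_le_reg_l with (epsQ n h lam P); auto.
      rewrite <- Rmult_assoc, Rinv_r, Rmult_1_l by lra.
      eapply Rle_trans; [|apply (rsum_term (seq 0 h) (fun k => Cnorm (scomp n (hot (g k) j) phi P)) k)].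
      + rewrite E; apply Rmult_le_compat_r; auto.
      + auto.
      + apply in_seq; lia. }
  eapply Rle_trans; [|apply Hs]. apply Rmult_le_compat_l; auto.
  rewrite Rpow_mult_distr; apply Rmult_le_compat_l; [apply pow_le; lra|].
  rewrite exp_pow. specialize (HKc Q HQ).
  destruct (Req_dec (- c * INR (sumQ Q)) (- K Q)) as [->|]; [lra|]. left; apply exp_increasing; lra.
Qed.

(** * The totally resonant case *)

(** Read in the coordinates given by a formal linearization [phi], averaging multiplies the terms of
    degree [q] by a scalar [m q]. *)
Definition degree_multiplier (n : nat) (phi X Y : fmap) (m : nat -> cplx) : Prop :=
  forall i Q, (i < n)%nat -> length Q = n ->
    fcomp n Y phi i Q = Cmul (m (sumQ Q)) (fcomp n X phi i Q).

(** The geometric sum in Horner form, matching the step Y -> X + e (Y o g) by which the average is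
    built. *)
Fixpoint geom (N : nat) (z : cplx) : cplx :=
  match N with O => C0 | S N => Cadd C1 (Cmul z (geom N z)) end.

Lemma geom_shift N z : Cadd (Cmul z (geom N z)) C1 = Cadd (geom N z) (Cpow z N).
Proof.
  induction N; simpl; [ring|].
  transitivity (Cadd (Cmul z (Cadd (Cmul z (geom N z)) C1)) C1); [ring|]. rewrite IHN; ring.
Qed.

Lemma geom_1 N : geom N C1 = (INR N, 0).
Proof.
  induction N; [reflexivity|]. rewrite S_INR; simpl; rewrite IHN.
  apply cplx_eq; simpl; ring.
Qed.

Lemma Cpow_add z p q : Cpow z (p + q) = Cmul (Cpow z p) (Cpow z q).
Proof. induction p; simpl; [ring|rewrite IHp; ring]. Qed.

Lemma Cpow_mul z w q : Cpow (Cmul z w) q = Cmul (Cpow z q) (Cpow w q).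
Proof. induction q; simpl; [ring|rewrite IHq; ring]. Qed.

Lemma Cpow_pow z p q : Cpow (Cpow z p) q = Cpow (Cpow z q) p.
Proof. induction p; simpl; [apply Cpow_1|rewrite Cpow_mul, IHp; ring]. Qed.

Lemma Cmon_const lam c Q i : (forall j, (i <= j < i + length Q)%nat -> lam j = c) ->
  Cmon lam Q i = Cpow c (sumQ Q).
Proof.
  revert i; induction Q as [|q Q IH]; simpl; intros i H; auto.
  rewrite H, IH, Cpow_add by (intros; try apply H; lia); reflexivity.
Qed.

Lemma fixes0_fadd n F G : fixes0 n F -> fixes0 n G -> fixes0 n (fadd F G).
Proof. intros HF HG i Hi; unfold fadd, sadd; rewrite HF, HG by auto; ring. Qed.

Lemma fixes0_fscal n c F : fixes0 n F -> fixes0 n (fscal c F).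
Proof. intros HF i Hi; unfold fscal, sscal; rewrite HF by auto; ring. Qed.

(** Y is the mean over i < d of c^(-i) X o g^i. In the coordinates [phi], g acts on degree q by c^q,
    so m q is the mean of the powers of z = c^(q-1). As z^d = 1, multiplying this mean by z leaves
    it unchanged, which is the last conclusion. *)
Lemma average n g phi c d X : (1 <= d)%nat -> Cpow c d = C1 ->
  convergent n g -> fixes0 n g -> fixes0 n phi ->
  feq n (fcomp n g phi) (fcomp n phi (diagmap n (fun _ => c))) ->
  convergent n X -> fixes0 n X ->
  exists Y m, convergent n Y /\ fixes0 n Y /\ degree_multiplier n phi X Y m /\
    m 1%nat = C1 /\ forall q, Cmul (m q) (Cpow c q) = Cmul c (m q).
Proof.
  intros Hd Hc Hg Hg0 Hphi0 Hgphi HX HX0.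
  (* The inverse of c, written as a power. *)
  set (e := Cpow c (d - 1)).
  assert (Cmul c e = C1) as He by (unfold e; rewrite <- Hc; replace d with (S (d - 1)) at 2 by lia; reflexivity).
  assert (forall N, exists Y, convergent n Y /\ fixes0 n Y /\
    degree_multiplier n phi X Y (fun q => geom N (Cmul e (Cpow c q)))) as HN.
  { induction N as [|N (Y & HY & HY0 & Hm)].
    - exists (fscal C0 X); repeat split; auto using convergent_fscal, fixes0_fscal.
      intros i Q Hi HQ; unfold fcomp, fscal; rewrite scomp_sscal; cbn [geom]; ring.
    - exists (fadd X (fscal e (fcomp n Y g))).
      repeat split; auto using convergent_fadd, convergent_fscal, convergent_fcomp, fixes0_fadd,
        fixes0_fscal, fixes0_comp.
      intros i Q Hi HQ.
      transitivity (Cadd (fcomp n X phi i Q) (Cmul e (fcomp n (fcomp n Y g) phi i Q))).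
      + unfold fcomp at 1, fadd, fscal; rewrite scomp_sadd, scomp_sscal; reflexivity.
      + assert (feq n (fcomp n (fcomp n Y g) phi) (fcomp n (fcomp n Y phi) (diagmap n (fun _ => c)))) as E.
        { rewrite !fcomp_assoc, Hgphi by auto with fix0; reflexivity. }
        rewrite E by auto. unfold fcomp at 2; rewrite scomp_diag, Hm, (Cmon_const _ c) by auto.
        cbn [geom]; ring. }
  destruct (HN d) as (Y & HY & HY0 & Hm).
  set (x := (/ INR d, 0) : cplx).
  exists (fscal x Y), (fun q => Cmul x (geom d (Cmul e (Cpow c q)))).
  repeat split; auto using convergent_fscal, fixes0_fscal.
  - intros i Q Hi HQ; unfold fcomp at 1, fscal; rewrite scomp_sscal; fold (fcomp n Y phi i).
    rewrite Hm by auto; ring.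
  - simpl Cpow; replace (Cmul e (Cmul c C1)) with C1 by (transitivity (Cmul c e); [auto|ring]).
    rewrite geom_1; unfold x; apply cplx_eq; simpl; [|ring]. field.
    apply not_0_INR; lia.
  - intros q; set (z := Cmul e (Cpow c q)).
    assert (Cpow z d = C1) as Hz.
    { unfold z, e; rewrite Cpow_mul, !(Cpow_pow c _ d), Hc, !Cpow_1; ring. }
    assert (Cmul z (geom d z) = geom d z) as Hfix.
    { pose proof (geom_shift d z) as E; rewrite Hz in E.
      transitivity (Csub (Cadd (Cmul z (geom d z)) C1) C1); [ring|rewrite E; ring]. }
    rewrite <- Hfix at 2.
    transitivity (Cmul (Cmul x (geom d z)) (Cmul (Cmul c e) (Cpow c q))); [rewrite He; ring|unfold z; ring].
Qed.

(** Averaging over one germ after another: the scalar multipliers are multiplied, so the relations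
    gained for earlier germs survive. *)
Lemma average_all n h g phi (c : nat -> cplx) d : (1 <= d)%nat -> 
  fixes0 n phi ->
  (forall k, (k < h)%nat -> Cpow (c k) d = C1 /\ convergent n (g k) /\ fixes0 n (g k) /\
    feq n (fcomp n (g k) phi) (fcomp n phi (diagmap n (fun _ => c k)))) ->
  exists Y m, convergent n Y /\ fixes0 n Y /\ degree_multiplier n phi (fid n) Y m /\
    m 1%nat = C1 /\ forall k q, (k < h)%nat -> Cmul (m q) (Cpow (c k) q) = Cmul (c k) (m q).
Proof.
  intros Hd Hphi0; induction h as [|h IH]; intros H.
  - exists (fid n), (fun _ => C1); repeat split; auto using convergent_linear, fid_linear with fix0.
    + intros i Q Hi HQ; ring.
    + intros; lia.
  - destruct IH as (X & m & HX & HX0 & Hm & Hm1 & Hmc); [auto|].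
    destruct (H h (Nat.lt_succ_diag_r h)) as (Hc & Hg & Hg0 & Hgphi).
    destruct (average n (g h) phi (c h) d X) as (Y & m' & HY & HY0 & Hm' & Hm1' & Hmc'); auto.
    exists Y, (fun q => Cmul (m' q) (m q)); repeat split; auto.
    + intros i Q Hi HQ; rewrite Hm', Hm by auto; ring.
    + rewrite Hm1, Hm1'; ring.
    + intros k q Hk; destruct (Nat.eq_dec k h) as [->|].
      * transitivity (Cmul (Cmul (m' q) (Cpow (c h) q)) (m q)); [ring|rewrite Hmc'; ring].
      * transitivity (Cmul (m' q) (Cmul (m q) (Cpow (c k) q))); [ring|rewrite Hmc by lia; ring].
Qed.

(** The averaged identity X satisfies X o g_k = c_k X for every k, so its local inverse linearizes
    all germs. *)
Lemma resonant_linearizable n h g phi (c : nat -> cplx) d : (1 <= d)%nat ->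
  fixes0 n phi -> feq n (linop n phi) (fid n) ->
  (forall k, (k < h)%nat -> Cpow (c k) d = C1 /\ convergent n (g k) /\ fixes0 n (g k) /\
    feq n (fcomp n (g k) phi) (fcomp n phi (diagmap n (fun _ => c k)))) ->
  simul_holo_linearizable n h g.
Proof.
  intros Hd H0 H1 H.
  destruct (average_all n h g phi c d) as (X & m & HX & HX0 & Hm & Hm1 & Hmc); auto.
  assert (feq n (linop n X) (fid n)) as HX1.
  { rewrite <- (fcomp_fid_r n (linop n X)), <- H1, <- linop_comp, H1, <- H1 by auto.
    apply linmap_ext; intros i j Hi Hj; unfold linpart.
    rewrite Hm, unitv_sum, Hm1, (fcomp_fid_l n phi) by auto using unitv_length; ring. }
  destruct (formal_inverse n phi) as (psi & Hpsi0 & _ & Hphipsi & _); auto.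
  destruct (local_inverse n X) as (Y & HY & _ & HY0 & HYX & HXY); auto.
  exists Y, X; repeat split; auto.
  intros k Hk; destruct (H k Hk) as (_ & _ & Hg0 & Hgphi).
  (* The identity is checked after composition with the formal map [phi], where both sides act by
     scalars in each degree, and [phi] is then cancelled by its formal inverse. *)
  assert (feq n (fcomp n X (g k)) (fcomp n (diagmap n (fun _ => c k)) X)) as E.
  { rewrite <- (fcomp_fid_r n (fcomp n X (g k))), <- (fcomp_fid_r n (fcomp n (diagmap n _) X)), <- Hphipsi.
    rewrite <- !fcomp_assoc by auto with fix0. apply fcomp_proper; [|reflexivity].
    rewrite !fcomp_assoc, Hgphi, <- fcomp_assoc by auto with fix0.
    intros i Hi Q HQ. rewrite (fcomp_diag_l n) by auto with fix0.
    unfold fcomp at 1; rewrite scomp_diag, (Cmon_const _ (c k)) by auto.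
    unfold sscal; rewrite Hm by auto.
    transitivity (Cmul (Cmul (m (sumQ Q)) (Cpow (c k) (sumQ Q))) (fcomp n (fid n) phi i Q)); [ring|].
    rewrite Hmc by auto; ring. }
  rewrite <- fcomp_assoc, E, fcomp_assoc, HXY, fcomp_fid_r by auto with fix0. apply diagmap_linear.
Qed.

(** * Conclusion *)

Lemma fcomp_cancel n F G H : fixes0 n G -> fixes0 n H -> feq n (fcomp n F G) (fid n) ->
  feq n (fcomp n F (fcomp n G H)) H.
Proof. intros HG HH E; rewrite <- fcomp_assoc, E, fcomp_fid_l by auto; reflexivity. Qed.

(** The invertible germ has an invertible linear part, so the diagonal map has a left inverse; a
    zero eigenvalue would annihilate its column i. *)
Lemma diagonal_part_nonzero n f P Pinv lam i : (i < n)%nat ->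
  germ_biholo0 n f -> is_linear n P -> is_linear n Pinv -> feq n (fcomp n Pinv P) (fid n) ->
  feq n (fcomp n P Pinv) (fid n) ->
  feq n (fcomp n (linop n f) P) (fcomp n P (diagmap n lam)) -> lam i <> C0.
Proof.
  intros Hi (_ & G & _ & Hf0 & HG0 & HGf & _) HP HPinv HPiP HPPi HfP E.
  assert (feq n (fcomp n (linop n G) (linop n f)) (fid n)) as Hl.
  { rewrite <- linop_comp, HGf by auto; apply linop_fid. }
  assert (feq n (fcomp n (fcomp n Pinv (fcomp n (linop n G) P)) (diagmap n lam)) (fid n)) as HX.
  { rewrite !fcomp_assoc, <- HfP by auto with fix0. rewrite (fcomp_cancel n (linop n G) (linop n f)) by auto with fix0; auto. }
  specialize (HX i Hi (unitv n i) (unitv_length n i)).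
  unfold fcomp at 1 in HX; rewrite scomp_diag, Cmon_unitv, Nat.add_0_r, E, fidE in HX
    by auto using unitv_length.
  destruct Nat.eq_dec; [|congruence].
  assert (C0 = C1) as E'; [rewrite <- HX; ring|]. injection E'; lra.
Qed.

Lemma simul_holo_linearizable_conj n h f P Pinv :
  is_linear n P -> is_linear n Pinv -> feq n (fcomp n Pinv P) (fid n) ->
  feq n (fcomp n P Pinv) (fid n) -> (forall k, (k < h)%nat -> fixes0 n (f k)) ->
  simul_holo_linearizable n h (fun k => fcomp n Pinv (fcomp n (f k) P)) ->
  simul_holo_linearizable n h f.
Proof.
  intros HP HPinv HPiP HPPi Hf (phi & psi & Hphi & Hpsi & (Hphi0 & Hpsi0 & Hpp & Hpp') & Hlin).
  pose proof (is_linear_fixes0 n P HP) as HP0; pose proof (is_linear_fixes0 n Pinv HPinv) as HPi0.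
  exists (fcomp n P phi), (fcomp n psi Pinv).
  repeat split; auto using convergent_fcomp, convergent_linear, fixes0_comp.
  - rewrite fcomp_assoc, (fcomp_cancel n Pinv P) by auto with fix0; auto.
  - rewrite fcomp_assoc, (fcomp_cancel n phi psi) by auto with fix0; auto.
  - intros k Hk; specialize (Hf k Hk); specialize (Hlin k Hk).
    rewrite !fcomp_assoc in Hlin by auto with fix0. rewrite !fcomp_assoc by auto with fix0; auto.
Qed.

Theorem theorem3p2 (n h : nat) (f : nat -> fmap) :
  (1 <= n)%nat -> (2 <= h)%nat ->
  (forall k, (k < h)%nat -> fixes0 n (f k) /\ germ_biholo0 n (f k)) ->
  simul_formally_linearizable n h f ->
  (exists (P lam : nat -> nat -> cplx),
      common_eigenbasis n h f P lam /\ simul_brjuno n h lam) ->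
  simul_holo_linearizable n h f.
Proof.
  intros Hn Hh Hf (phi0 & psi0 & (Hphi0 & Hpsi0 & Hpp & Hpp') & Hlin)
    (A & lam & ((Ainv & HA & HA') & HAf) & Hbr).
  set (P := linmap n A); set (Pi := linmap n Ainv).
  assert (is_linear n P) as HP by apply linmap_linear.
  assert (is_linear n Pi) as HPi by apply linmap_linear.
  assert (feq n (fcomp n P Pi) (fid n)) as HPPi by (unfold P, Pi; rewrite linmap_comp; apply linmap_id, HA).
  assert (feq n (fcomp n Pi P) (fid n)) as HPiP by (unfold P, Pi; rewrite linmap_comp; apply linmap_id, HA').
  assert (forall k, (k < h)%nat -> feq n (fcomp n (linop n (f k)) P) (fcomp n P (diagmap n (lam k)))) as HfP.
  { intros k Hk; unfold P, linop; rewrite linmap_comp, (linmap_ext n _ _ (HAf k Hk)), linmap_diag; reflexivity. }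
  apply (simul_holo_linearizable_conj n h f P Pi); auto; [apply Hf|].
  set (g := fun k => fcomp n Pi (fcomp n (f k) P)).
  set (a := linop n phi0); set (a' := linop n psi0).
  assert (feq n (fcomp n a a') (fid n)) as Haa'.
  { unfold a, a'; rewrite <- linop_comp, Hpp' by auto; apply linop_fid. }
  (* Composing [phi0] with the inverse [a'] of its linear part makes it tangent to the identity;
     conjugation by [P] moves it to the diagonalizing coordinates. *)
  set (phi := fcomp n Pi (fcomp n phi0 (fcomp n a' P))).
  assert (fixes0 n a) as Ha0 by apply linop_fixes0.
  assert (fixes0 n a') as Ha'0 by apply linop_fixes0.
  assert (fixes0 n phi) as Hphi by (unfold phi; auto 10 with fix0).
  assert (feq n (linop n phi) (fid n)) as Hphi1.
  { unfold phi; rewrite !linop_comp by auto with fix0.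
    rewrite (linop_linear n P), (linop_linear n Pi), (linop_linear n a') by (auto; apply linmap_linear).
    fold a; rewrite (fcomp_cancel n a a') by auto with fix0; auto. }
  assert (forall k, (k < h)%nat -> convergent n (g k) /\ fixes0 n (g k) /\
     feq n (linop n (g k)) (diagmap n (lam k)) /\
     feq n (fcomp n (g k) phi) (fcomp n phi (diagmap n (lam k)))) as Hg.
  { intros k Hk; destruct (Hf k Hk) as (Hf0 & Hfc & _); unfold g; repeat split.
    - auto 10 using convergent_fcomp, convergent_linear with fix0.
    - auto with fix0.
    - rewrite !linop_comp, (linop_linear n P), (linop_linear n Pi), HfP, (fcomp_cancel n Pi P) by auto with fix0.
      reflexivity.
    (* Being linear, L is its own linear part, hence the linear part of f_k conjugated by [a]. So
       the normalized map conjugates f_k to its linear part. *)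
    - set (L := fcomp n psi0 (fcomp n (f k) phi0)).
      assert (feq n L (fcomp n a' (fcomp n (linop n (f k)) a))) as HL.
      { rewrite <- (linop_linear n L (Hlin k Hk)). unfold L; rewrite !linop_comp by auto with fix0; reflexivity. }
      assert (feq n (fcomp n (f k) phi0) (fcomp n phi0 L)) as Hfphi.
      { unfold L; rewrite (fcomp_cancel n phi0 psi0) by auto with fix0; reflexivity. }
      assert (fixes0 n L) as HL0 by (unfold L; auto with fix0).
      unfold phi; rewrite !fcomp_assoc by auto 10 with fix0.
      rewrite (fcomp_cancel n P Pi) by auto 10 with fix0.
      rewrite <- (fcomp_assoc n (f k) phi0), Hfphi, fcomp_assoc, HL by auto with fix0.
      rewrite !fcomp_assoc, (fcomp_cancel n a a'), HfP by auto with fix0.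
      reflexivity. }
  assert (forall k j, (k < h)%nat -> (j < n)%nat -> lam k j <> C0) as Hlam.
  { intros k j Hk Hj; apply (diagonal_part_nonzero n (f k) P Pi); auto; apply Hf; auto. }
  destruct (classic (exists Q, length Q = n /\ (2 <= sumQ Q)%nat /\ totally_resonant n h lam Q = true))
    as [(Q & HQ & HQ2 & Hres)|Hnres].
  - assert (forall k j, (k < h)%nat -> (j < n)%nat -> Cmon (lam k) Q 0 = lam k j) as Hr.
    { intros k j Hk Hj; unfold totally_resonant in Hres.
      rewrite forallb_forall in Hres; specialize (Hres k); rewrite in_seq, forallb_forall in Hres.
      specialize (Hres ltac:(lia) j); rewrite in_seq in Hres; specialize (Hres ltac:(lia)).
      destruct Ceq_dec; [auto|discriminate]. }
    (* Total resonance equates every lambda_(k,j) with Lambda_k^Q, which does not depend on j. *)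
    assert (forall k j, (k < h)%nat -> (j < n)%nat -> lam k j = lam k 0%nat) as Hconst.
    { intros k j Hk Hj; rewrite <- !Hr by (auto; lia); reflexivity. }
    (* For a scalar linear part the resonance reads c^|Q| = c with c nonzero, so c^(|Q| - 1) = 1,
       with one exponent for all k. *)
    apply (resonant_linearizable n h g phi (fun k => lam k 0%nat) (sumQ Q - 1)); auto; [lia|].
    intros k Hk; destruct (Hg k Hk) as (Hgc & Hg0 & _ & Hgphi); repeat split; auto.
    + specialize (Hr k 0%nat Hk ltac:(lia)).
      rewrite (Cmon_const _ (lam k 0%nat)) in Hr by (intros; apply Hconst; lia).
      destruct (Cmul_integral (lam k 0%nat) (Csub (Cpow (lam k 0%nat) (sumQ Q - 1)) C1)) as [E|E].
      * replace (sumQ Q) with (S (sumQ Q - 1)) in Hr by lia; simpl Cpow in Hr.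
        transitivity (Csub (Cmul (lam k 0%nat) (Cpow (lam k 0%nat) (sumQ Q - 1))) (lam k 0%nat)); [ring|].
        rewrite Hr; ring.
      * destruct (Hlam k 0%nat); auto; lia.
      * transitivity (Cadd (Csub (Cpow (lam k 0%nat) (sumQ Q - 1)) C1) C1); [ring|rewrite E; ring].
    + rewrite Hgphi; apply fcomp_proper; [reflexivity|].
      intros i Hi R HR; unfold diagmap, sscal; rewrite Hconst by auto; reflexivity.
  - destruct (local_inverse n phi) as (psi & Hpsi & Hinv); auto.
    { apply (nonresonant_convergent n h lam g phi); auto; [lia|].
      intros Q HQ HQ2; destruct (totally_resonant n h lam Q) eqn:E; auto. destruct Hnres; eauto. }
    exists phi, psi; repeat split; try apply Hinv; auto.
    { apply (nonresonant_convergent n h lam g phi); auto; [lia|].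
      intros Q HQ HQ2; destruct (totally_resonant n h lam Q) eqn:E; auto. destruct Hnres; eauto. }
    destruct Hinv as (_ & Hpsi0' & Hpsiphi & _).
    intros k Hk; destruct (Hg k Hk) as (_ & _ & _ & E).
    rewrite E, (fcomp_cancel n psi phi) by auto with fix0. apply diagmap_linear.
Qed.
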